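(* Let $A=kQ/I$ be a gentle algebra. Let $X=\bigoplus X_i$ with each $X_i$ a string. A string $Y$ is in $\operatorname{Fac}X$ if and only if $Y$ can be written as a union of strings, each of which is a substring of $Y$ and a factor of some $X_i$. Here, that $Y$ is a union of a certain set of strings means that the strings may overlap, but each arrow of $Y$ occurs in at least one of the strings.
   Context: **Gentle algebras.** $k$ is a field. Quivers $Q=(Q_0,Q_1,s,e)$ are finite and connected; $s(\gamma),e(\gamma)$ are the source and target of an arrow $\gamma$. Paths are written right to left: $\gamma_m\cdots\gamma_1$ is a path if $s(\gamma_{j+1})=e(\gamma_j)$. $A=kQ/I$ is gentle if $I$ is an admissible ideal generated by paths of length two, every vertex has at most two incoming and two outgoing arrows, and for every arrow $\alpha$ there is at most one arrow $\beta$ with $\alpha\beta$ a path not in $I$, at most one $\gamma$ with $\gamma\alpha$ a path not in $I$, at most one $\beta$ with $\alpha\beta$ a path in $I$, and at most one $\gamma$ with $\gamma\alpha$ a path in $I$. **Strings.** To each arrow $\delta$ associate a formal inverse $\delta^{-1}$ with $s(\delta^{-1})=e(\delta)$, $e(\delta^{-1})=s(\delta)$. A string in $Q$ is either a lazy path $e_x$ at a vertex $x$ (length zero, its own inverse) or a path $C=\gamma_n\cdots\gamma_1$ whose letters are arrows (''direct'') or formal inverses (''inverse''), such that no letter is followed by its inverse and neither $C$ nor $C^{-1}$ contains a subpath in $I$. The string module $M(C)$ has basis $z_0,\dots,z_n$ placed at the successive vertices of $C$; a direct $\gamma_i$ sends $z_{i-1}$ to $z_i$, and if $\gamma_i=\delta^{-1}$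 then $\delta$ sends $z_i$ to $z_{i-1}$; all other actions of arrows are zero. $M(C)\cong M(C^{-1})$; strings $C$ and $C^{-1}$ are identified, and $C$ also denotes $M(C)$. **Substrings and factors.** Write $C=FED$ with $F,E,D$ strings (possibly lazy). Then $E$ is a substring of $C$. $E$ is a factor of $C$ (via this factorization) if $D$ is lazy or its last (leftmost) letter is inverse, and $F$ is lazy or its first (rightmost) letter is direct; in this case there is an induced surjection from the module $C$ onto the module $E$. **Fac.** $\operatorname{Fac}X$ is the full subcategory of the category $\operatorname{mod}A$ of $A$-modules consisting of quotients of sums of copies of $X$.
   Formalization: ''Substring of Y'' is read as a substring E, Y=FED, spanning a submodule (D lazy or its last letter direct, F lazy or its first letter inverse), and the union is of at least one string; with arbitrary substrings it fails: Q: 1-a->2-b->3, I=0, X=a⊕b, Y=ba. *)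

(* Defs.v *)
From HB Require Import structures.
From mathcomp Require Import all_boot all_order all_algebra.
From mathcomp Require Import finmap generic_quotient ring_quotient.
From mathcomp Require Import monalg.

Set Implicit Arguments.
Unset Strict Implicit.
Unset Printing Implicit Defensive.

Import GRing.Theory.

Local Open Scope ring_scope.
Local Open Scope quotient_scope.

(** * Two-sided ideals and quotient rings *)

Definition ideal_closed (R : pzRingType) (J : R -> Prop) : Prop :=
  [/\ J 0, forall x y, J x -> J y -> J (x - y),
      forall a x, J x -> J (a * x) & forall a x, J x -> J (x * a)].

(* The carrier is a boolean predicate, so that {quot I} is available. *)
Record ideal (R : pzRingType) := Ideal {
  ideal_pred :> {pred R};
  idealP : ideal_closed (fun x => x \in ideal_pred) }.

Definition ideal_gen (R : pzRingType) (S : R -> Prop) (x : R) : Prop :=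
  forall J : R -> Prop, ideal_closed J -> (forall y, S y -> J y) -> J x.

Fixpoint ideal_pow (R : pzRingType) (J : R -> Prop) (n : nat) : R -> Prop :=
  if n is n'.+1 then
    ideal_gen (fun z => exists x y, [/\ J x, ideal_pow J n' y & z = x * y])
  else fun=> True.

Section IdealQuotient.
Variables (R : pzRingType) (I : ideal R).

Lemma ideal_zmod_closed : zmod_closed (ideal_pred I).
Proof. by case: (idealP I) => I0 IB _ _; split=> // x y; apply: IB. Qed.

HB.instance Definition _ :=
  GRing.isZmodClosed.Build R (ideal_pred I) ideal_zmod_closed.

Definition quot_ring : Type := Quotient.quot (ideal_pred I).

HB.instance Definition _ := GRing.Zmodule.on quot_ring.
HB.instance Definition _ := EqQuotient.on quot_ring.

Lemma quot_ring_eqP (x y : R) :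
  reflect (x = y %[mod quot_ring]) (x - y \in I).
Proof. by rewrite (Quotient.idealrBE (ideal_pred I)); apply: eqP. Qed.

Definition quot_one : quot_ring := \pi_quot_ring 1.
Definition quot_mul : quot_ring -> quot_ring -> quot_ring :=
  lift_op2 quot_ring *%R.

Lemma pi_quotD x y : \pi_quot_ring (x + y) = \pi_quot_ring x + \pi_quot_ring y.
Proof. exact: (@Quotient.pi_add R (ideal_pred I)). Qed.

Lemma pi_quot_mul x y :
  quot_mul (\pi_quot_ring x) (\pi_quot_ring y) = \pi_quot_ring (x * y).
Proof.
unlock quot_mul; apply/quot_ring_eqP.
set x' := repr _; set y' := repr _.
have Ix : x' - x \in I by apply/quot_ring_eqP; rewrite /x' reprK.
have Iy : y' - y \in I by apply/quot_ring_eqP; rewrite /y' reprK.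
case: (idealP I) => _ _ Il Ir.
have -> : x' * y' - x * y = x' * (y' - y) + (x' - x) * y.
  by rewrite mulrBr mulrBl addrA subrK.
exact: (rpredD (Il _ _ Iy) (Ir _ _ Ix)).
Qed.

Lemma quot_mulA : associative quot_mul.
Proof.
move=> x y z; rewrite -[x]reprK -[y]reprK -[z]reprK.
by rewrite !pi_quot_mul mulrA.
Qed.

Lemma quot_mul1l : left_id quot_one quot_mul.
Proof. by move=> x; rewrite -[x]reprK pi_quot_mul mul1r. Qed.

Lemma quot_mul1r : right_id quot_one quot_mul.
Proof. by move=> x; rewrite -[x]reprK pi_quot_mul mulr1. Qed.

Lemma quot_mulDl : left_distributive quot_mul +%R.
Proof.
move=> x y z; rewrite -[x]reprK -[y]reprK -[z]reprK.
by rewrite -pi_quotD !pi_quot_mul mulrDl pi_quotD.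
Qed.

Lemma quot_mulDr : right_distributive quot_mul +%R.
Proof.
move=> x y z; rewrite -[x]reprK -[y]reprK -[z]reprK.
by rewrite -pi_quotD !pi_quot_mul mulrDr pi_quotD.
Qed.

HB.instance Definition _ := GRing.Zmodule_isPzRing.Build quot_ring
  quot_mulA quot_mul1l quot_mul1r quot_mulDl quot_mulDr.

End IdealQuotient.

(** * Direct sums and Fac *)

Section DirectSum.
Variables (R : pzRingType) (T : finType) (M : T -> lmodType R).

Definition dsum : Type := {dffun forall i : T, M i}.

HB.instance Definition _ := Choice.on dsum.

Implicit Types u v : dsum.

Definition dsum0 : dsum := [ffun i => 0 : M i].
Definition dsum_opp u : dsum := [ffun i => - u i].
Definition dsum_add u v : dsum := [ffun i => u i + v i].
Definition dsum_scale (a : R) u : dsum := [ffun i => a *: u i].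

Lemma dsum_addA : associative dsum_add.
Proof. by move=> u v w; apply/ffunP=> i; rewrite !ffunE addrA. Qed.
Lemma dsum_addC : commutative dsum_add.
Proof. by move=> u v; apply/ffunP=> i; rewrite !ffunE addrC. Qed.
Lemma dsum_add0 : left_id dsum0 dsum_add.
Proof. by move=> u; apply/ffunP=> i; rewrite !ffunE add0r. Qed.
Lemma dsum_addN : left_inverse dsum0 dsum_opp dsum_add.
Proof. by move=> u; apply/ffunP=> i; rewrite !ffunE addNr. Qed.

HB.instance Definition _ :=
  GRing.isZmodule.Build dsum dsum_addA dsum_addC dsum_add0 dsum_addN.

Lemma dsum_scaleA a b u : dsum_scale a (dsum_scale b u) = dsum_scale (a * b) u.
Proof. by apply/ffunP=> i; rewrite !ffunE scalerA. Qed.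
Lemma dsum_scale1 : left_id 1 dsum_scale.
Proof. by move=> u; apply/ffunP=> i; rewrite !ffunE scale1r. Qed.
Lemma dsum_scaleDr : right_distributive dsum_scale +%R.
Proof. by move=> a u v; apply/ffunP=> i; rewrite !ffunE scalerDr. Qed.
Lemma dsum_scaleDl u : {morph dsum_scale^~ u : a b / a + b}.
Proof. by move=> a b; apply/ffunP=> i; rewrite !ffunE scalerDl. Qed.

HB.instance Definition _ := GRing.Zmodule_isLmodule.Build R dsum
  dsum_scaleA dsum_scale1 dsum_scaleDr dsum_scaleDl.

End DirectSum.

(* {ffun 'I_n -> X} is the direct sum of n copies of X. *)
(* Modules are not required to be finite-dimensional; everything in Fac X is
   as soon as X is. *)
Definition Fac (A : pzRingType) (X Y : lmodType A) : Prop :=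
  exists (n : nat) (f : {linear {ffun 'I_n -> X} -> Y}),
    forall y : Y, exists x, f x = y.

(** * Quivers and path algebras *)

Record quiver := Quiver {
  vertex : finType;
  arrow : finType;
  src : arrow -> vertex;
  tgt : arrow -> vertex }.

Definition adjacent (Q : quiver) : rel (vertex Q) := fun x y =>
  [exists a : arrow Q, ((src a == x) && (tgt a == y))
                    || ((src a == y) && (tgt a == x))].

Definition connected (Q : quiver) : Prop :=
  inhabited (vertex Q) /\ forall x y : vertex Q, connect (@adjacent Q) x y.

Fixpoint walk (V : eqType) (L : Type) (s t : L -> V) (x : V) (l : seq L)
    : bool :=
  if l is c :: l' then (s c == x) && walk s t (t c) l' else true.

Fixpoint walk_end (V L : Type) (t : L -> V) (x : V) (l : seq L) : V :=
  if l is c :: l' then walk_end t (t c) l' else x.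

Section Walks.
Variables (V : eqType) (L : Type) (s t : L -> V).

Lemma walk_cat x l1 l2 : walk s t x (l1 ++ l2) =
  walk s t x l1 && walk s t (walk_end t x l1) l2.
Proof. by elim: l1 x => //= c l1 IH x; rewrite IH andbA. Qed.

Lemma walk_end_cat x l1 l2 :
  walk_end t x (l1 ++ l2) = walk_end t (walk_end t x l1) l2.
Proof. by elim: l1 x => //=. Qed.

End Walks.

Section Paths.
Variable Q : quiver.

(* A path g_m ... g_1 is stored with its starting vertex and the list
   [:: g_1; ...; g_m], i.e. from right to left. *)
Record qpath := QPath {
  qdata : vertex Q * seq (arrow Q);
  qpath_walk : walk (@src Q) (@tgt Q) qdata.1 qdata.2 }.

HB.instance Definition _ := [isSub for qdata].
HB.instance Definition _ := [Choice of qpath by <:].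

Definition psrc (p : qpath) : vertex Q := (qdata p).1.
Definition parrows (p : qpath) : seq (arrow Q) := (qdata p).2.
Definition ptgt (p : qpath) : vertex Q := walk_end (@tgt Q) (psrc p) (parrows p).

Definition lazy_path (x : vertex Q) : qpath := @QPath (x, [::]) isT.

Lemma arrow_path_subproof (a : arrow Q) :
  walk (@src Q) (@tgt Q) (src a) [:: a].
Proof. by rewrite /= eqxx. Qed.
Definition arrow_path (a : arrow Q) : qpath :=
  @QPath (src a, [:: a]) (arrow_path_subproof a).

(* [pcomp q p] is the path qp: first p, then q. *)
Definition pcomp (q p : qpath) : option qpath :=
  if ptgt p == psrc q then insub (psrc p, parrows p ++ parrows q) else None.

Lemma pcompP q p : ptgt p = psrc q ->
  {r | pcomp q p = Some r &
       psrc r = psrc p /\ parrows r = parrows p ++ parrows q}.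
Proof.
move=> Epq; rewrite /pcomp Epq eqxx.
have W : walk (@src Q) (@tgt Q) (psrc p) (parrows p ++ parrows q).
  by rewrite walk_cat (qpath_walk p) /= -/(ptgt p) Epq (qpath_walk q).
pose P (u : vertex Q * seq (arrow Q)) := walk (@src Q) (@tgt Q) u.1 u.2.
by rewrite (@insubT _ P _ (psrc p, parrows p ++ parrows q) W); eexists.
Qed.

Lemma pcomp_none q p : ptgt p != psrc q -> pcomp q p = None.
Proof. by rewrite /pcomp => /negPf->. Qed.

Lemma qpath_eq p q : psrc p = psrc q -> parrows p = parrows q -> p = q.
Proof.
case: p q => -[x l] H [[y l'] H']; rewrite /psrc /parrows /= => Ex El.
by apply/val_inj; rewrite /= Ex El.
Qed.

Lemma ptgt_comp q p r : pcomp q p = Some r -> ptgt r = ptgt q.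
Proof.
case: (eqVneq (ptgt p) (psrc q)) => [E|/pcomp_none -> //].
case: (pcompP E) => r' -> [Es Ea] [<-].
by rewrite /ptgt Es Ea walk_end_cat -/(ptgt p) E.
Qed.

Lemma psrc_comp q p r : pcomp q p = Some r -> psrc r = psrc p.
Proof.
case: (eqVneq (ptgt p) (psrc q)) => [E|/pcomp_none -> //].
by case: (pcompP E) => r' -> [Es Ea] [<-].
Qed.

Lemma pcompA r q p :
  obind (pcomp r) (pcomp q p) = obind (pcomp^~ p) (pcomp r q).
Proof.
case: (eqVneq (ptgt p) (psrc q)) => [Epq|N].
  case: (pcompP Epq) => qp Eqp [Sqp Aqp]; rewrite Eqp /=.
  case: (eqVneq (ptgt q) (psrc r)) => [Eqr|N].
    case: (pcompP Eqr) => rq Erq [Srq Arq]; rewrite Erq /=.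
    have E1 : ptgt qp = psrc r by rewrite (ptgt_comp Eqp).
    have E2 : ptgt p = psrc rq by rewrite Srq.
    case: (pcompP E1) => u -> [Su Au]; case: (pcompP E2) => v -> [Sv Av].
    congr Some; apply: qpath_eq; first by rewrite Su Sv Sqp.
    by rewrite Au Av Aqp Arq catA.
  by rewrite !pcomp_none // (ptgt_comp Eqp).
rewrite pcomp_none //=.
case E: (pcomp r q) => [rq|] //=; rewrite pcomp_none //.
by rewrite (psrc_comp E).
Qed.

Lemma pcomp_lazyl x p :
  pcomp (lazy_path x) p = if ptgt p == x then Some p else None.
Proof.
case: eqVneq => [E|N]; last by rewrite pcomp_none.
have E' : ptgt p = psrc (lazy_path x) by [].
case: (pcompP E') => r -> [Sr Ar]; congr Some; apply: qpath_eq => //.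
by rewrite Ar cats0.
Qed.

Lemma pcomp_lazyr x p :
  pcomp p (lazy_path x) = if psrc p == x then Some p else None.
Proof.
case: eqVneq => [E|N]; last by rewrite pcomp_none // eq_sym.
have E' : ptgt (lazy_path x) = psrc p by [].
case: (pcompP E') => r -> [Sr Ar]; congr Some; apply: qpath_eq => //.
by rewrite Sr E.
Qed.

End Paths.

Definition pathalg (k : fieldType) (Q : quiver) : Type := {malg k[qpath Q]}.
HB.instance Definition _ (k : fieldType) (Q : quiver) :=
  GRing.Lmodule.on (pathalg k Q).

(* The path p as an element of kQ; locked to keep unification from unfolding
   it into a finite map. *)
HB.lock Definition pelt (k : fieldType) (Q : quiver) (p : qpath Q) :
  pathalg k Q := mkmalgU p 1.
Arguments pelt k {Q} p.
Lemma peltE (k : fieldType) (Q : quiver) (p : qpath Q) :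
  pelt k p = mkmalgU p 1.
Proof. by rewrite unlock. Qed.

Section PathAlgebra.
Variables (k : fieldType) (Q : quiver).
Local Notation pathalg := (pathalg k Q).
Local Notation pelt := (@pelt k Q).

Definition varr (a : arrow Q) : pathalg := pelt (arrow_path a).

(* Linear extension of a map defined on the basis of paths. *)
Definition lin_ext (V : lmodType k) (phi : qpath Q -> V) (a : pathalg) : V :=
  \sum_(p <- msupp a) mcoeff p a *: phi p.

Section LinExt.
Variable V : lmodType k.
Implicit Types (phi : qpath Q -> V) (a b : pathalg).

Lemma lin_extw phi a (d : {fset qpath Q}) : (msupp a `<=` d)%fset ->
  lin_ext phi a = \sum_(p <- d) mcoeff p a *: phi p.
Proof.
move=> sad; rewrite /lin_ext (big_fset_incl _ sad) //= => p _.
by move/mcoeff_outdom->; rewrite scale0r.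
Qed.

Lemma lin_extP phi c a b :
  lin_ext phi (c *: a + b) = c *: lin_ext phi a + lin_ext phi b.
Proof.
pose d := (msupp a `|` msupp b `|` msupp (c *: a + b))%fset.
have sa : (msupp a `<=` d)%fset by rewrite /d -fsetUA fsubsetUl.
have sb : (msupp b `<=` d)%fset.
  by rewrite /d (fsetUC (msupp a)) -fsetUA fsubsetUl.
have sc : (msupp (c *: a + b) `<=` d)%fset by rewrite fsubsetUr.
rewrite (lin_extw _ sa) (lin_extw _ sb) (lin_extw _ sc) scaler_sumr -big_split.
by apply: eq_bigr => p _ /=; rewrite mcoeffD mcoeffZ scalerDl scalerA.
Qed.

Lemma lin_ext_pelt phi p : lin_ext phi (pelt p) = phi p.
Proof.
rewrite peltE.
by rewrite (@lin_extw phi _ [fset p]%fset msuppU_le) big_seq_fset1 mcoeffUU scale1r.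
Qed.

Lemma lin_extD phi : {morph lin_ext phi : a b / a + b}.
Proof. by move=> a b; rewrite -[a]scale1r lin_extP !scale1r. Qed.

Lemma lin_ext0 phi : lin_ext phi 0 = 0.
Proof. by rewrite /lin_ext msupp0 big_seq_fset0. Qed.

Lemma lin_extZ phi c a : lin_ext phi (c *: a) = c *: lin_ext phi a.
Proof. by rewrite -[c *: a]addr0 lin_extP lin_ext0 addr0. Qed.

Lemma lin_extB phi : {morph lin_ext phi : a b / a - b}.
Proof. by move=> a b; rewrite lin_extD -(scaleN1r b) lin_extZ scaleN1r. Qed.

Lemma lin_ext_sum phi (J : Type) (r : seq J) (P : pred J) (F : J -> pathalg) :
  lin_ext phi (\sum_(j <- r | P j) F j) = \sum_(j <- r | P j) lin_ext phi (F j).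
Proof. exact: (big_morph _ (lin_extD phi) (lin_ext0 phi)). Qed.

End LinExt.

Lemma pathalgE (a : pathalg) : a = \sum_(p <- msupp a) mcoeff p a *: pelt p.
Proof.
rewrite {1}[a]monalgE; apply: eq_bigr => p _; apply/malgP=> q.
rewrite mcoeffU; apply/esym/(etrans (mcoeffZ (mcoeff p a) (pelt p) q)).
by rewrite peltE mcoeffU mulr_natr.
Qed.

(* Two additive and homogeneous maps agreeing on paths are equal. *)
Lemma pathalg_ext (V : lmodType k) (f g : pathalg -> V) :
  (forall c a b, f (c *: a + b) = c *: f a + f b) ->
  (forall c a b, g (c *: a + b) = c *: g a + g b) ->
  (forall p, f (pelt p) = g (pelt p)) -> f =1 g.
Proof.
move=> lf lg fg a.
have z (h : pathalg -> V) :
    (forall c a b, h (c *: a + b) = c *: h a + h b) -> h 0 = 0.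
  by move=> lh; have := lh (-1) 0 0; rewrite scaler0 addr0 scaleN1r addNr.
rewrite [a]pathalgE; elim/big_rec: _ => [|p b _ IH]; first by rewrite !z.
by rewrite lf lg fg IH.
Qed.

Definition pmul (q p : qpath Q) : pathalg := oapp pelt 0 (pcomp q p).
Definition pathalg_mul (a b : pathalg) : pathalg :=
  lin_ext (fun q => lin_ext (pmul q) b) a.
Definition pathalg_one : pathalg := \sum_(x : vertex Q) pelt (lazy_path x).

Lemma pathalg_mulPl c a a' b :
  pathalg_mul (c *: a + a') b = c *: pathalg_mul a b + pathalg_mul a' b.
Proof. exact: lin_extP. Qed.

Lemma pathalg_mulPr c a b b' :
  pathalg_mul a (c *: b + b') = c *: pathalg_mul a b + pathalg_mul a b'.
Proof.
rewrite /pathalg_mul /lin_ext scaler_sumr -big_split; apply: eq_bigr => q _ /=.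
by rewrite -/(lin_ext _ _) lin_extP scalerDr !scalerA mulrC.
Qed.

Lemma pathalg_mul_pelt q p : pathalg_mul (pelt q) (pelt p) = pmul q p.
Proof. by rewrite /pathalg_mul !lin_ext_pelt. Qed.

Lemma pathalg_mul0 a : pathalg_mul a 0 = 0.
Proof.
have := pathalg_mulPr (-1) a 0 0.
by rewrite scaler0 addr0 scaleN1r addNr.
Qed.
Lemma pathalg_0mul a : pathalg_mul 0 a = 0.
Proof. exact: lin_ext0. Qed.

Lemma pathalg_mulDl : left_distributive pathalg_mul +%R.
Proof. by move=> a b c; rewrite -[a]scale1r pathalg_mulPl !scale1r. Qed.
Lemma pathalg_mulDr : right_distributive pathalg_mul +%R.
Proof. by move=> a b c; rewrite -[b]scale1r pathalg_mulPr !scale1r. Qed.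

Lemma pathalg_mul1l : left_id pathalg_one pathalg_mul.
Proof.
apply: (@pathalg_ext pathalg (pathalg_mul pathalg_one) id) => [t a a'||p] //.
  exact: pathalg_mulPr.
rewrite /pathalg_mul /pathalg_one lin_ext_sum.
under eq_bigr => x _ do rewrite !lin_ext_pelt /pmul pcomp_lazyl.
rewrite (bigD1 (ptgt p)) //= eqxx /= big1 ?addr0 // => x.
by rewrite eq_sym => /negPf->.
Qed.

Lemma pathalg_mul1r : right_id pathalg_one pathalg_mul.
Proof.
apply: (@pathalg_ext pathalg (pathalg_mul^~ pathalg_one) id)
  => [t a a'||p] //.
  exact: pathalg_mulPl.
rewrite /pathalg_mul /pathalg_one lin_ext_pelt lin_ext_sum.
under eq_bigr => x _ do rewrite !lin_ext_pelt /pmul pcomp_lazyr.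
rewrite (bigD1 (psrc p)) //= eqxx /= big1 ?addr0 // => x.
by rewrite eq_sym => /negPf->.
Qed.

Lemma pathalg_mulA : associative pathalg_mul.
Proof.
move=> a b c; move: a.
pose f1 a := pathalg_mul a (pathalg_mul b c).
pose g1 a := pathalg_mul (pathalg_mul a b) c.
apply: (@pathalg_ext pathalg f1 g1) => [t a a'|t a a'|p]; rewrite /f1 /g1.
- by rewrite pathalg_mulPl.
- by rewrite !pathalg_mulPl.
move: b {f1 g1}.
pose f2 b := pathalg_mul (pelt p) (pathalg_mul b c).
pose g2 b := pathalg_mul (pathalg_mul (pelt p) b) c.
apply: (@pathalg_ext pathalg f2 g2) => [t b b'|t b b'|q]; rewrite /f2 /g2.
- by rewrite pathalg_mulPl pathalg_mulPr.
- by rewrite pathalg_mulPr pathalg_mulPl.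
move: c {f2 g2}.
pose f3 c := pathalg_mul (pelt p) (pathalg_mul (pelt q) c).
pose g3 c := pathalg_mul (pathalg_mul (pelt p) (pelt q)) c.
apply: (@pathalg_ext pathalg f3 g3) => [t c c'|t c c'|r]; rewrite /f3 /g3.
- by rewrite (pathalg_mulPr t (pelt q)) pathalg_mulPr.
- exact: pathalg_mulPr.
rewrite !pathalg_mul_pelt /pmul.
have := pcompA p q r.
case: (pcomp q r) => [qr|]; case: (pcomp p q) => [pq|] /= E.
- by rewrite !pathalg_mul_pelt /pmul E.
- by rewrite (pathalg_0mul (pelt r)) pathalg_mul_pelt /pmul E.
- by rewrite (pathalg_mul0 (pelt p)) pathalg_mul_pelt /pmul -E.
by rewrite (pathalg_0mul (pelt r)) (pathalg_mul0 (pelt p)).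
Qed.

HB.instance Definition _ := GRing.Zmodule_isPzRing.Build pathalg
  pathalg_mulA pathalg_mul1l pathalg_mul1r pathalg_mulDl pathalg_mulDr.

Definition arrow_ideal : pathalg -> Prop :=
  ideal_gen (fun x : pathalg => exists a, x = varr a).

Definition admissible (I : ideal pathalg) : Prop :=
  (exists2 m, (2 <= m)%N & forall x, ideal_pow arrow_ideal m x -> x \in I)
  /\ forall x, x \in I -> ideal_pow arrow_ideal 2 x.

Definition gen_by_length_two (I : ideal pathalg) : Prop :=
  exists2 S : qpath Q -> Prop,
    forall p, S p -> size (parrows p) = 2%N &
    forall x, (x \in I) <->
      ideal_gen (fun y : pathalg => exists2 p, S p & y = pelt p) x.

(* The product [varr a * varr b] is the path ab ("b, then a") when
   [tgt b = src a]. *)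
Record gentle (I : ideal pathalg) : Prop := Gentle {
  gentle_connected : connected Q;
  gentle_admissible : admissible I;
  gentle_gen : gen_by_length_two I;
  gentle_in : forall x : vertex Q, (#|[set a : arrow Q | tgt a == x]| <= 2)%N;
  gentle_out : forall x : vertex Q, (#|[set a : arrow Q | src a == x]| <= 2)%N;
  gentle_notin_l : forall a b b' : arrow Q, tgt b = src a -> tgt b' = src a ->
    varr a * varr b \notin I -> varr a * varr b' \notin I -> b = b';
  gentle_notin_r : forall a c c' : arrow Q, src c = tgt a -> src c' = tgt a ->
    varr c * varr a \notin I -> varr c' * varr a \notin I -> c = c';
  gentle_in_l : forall a b b' : arrow Q, tgt b = src a -> tgt b' = src a ->
    varr a * varr b \in I -> varr a * varr b' \in I -> b = b';
  gentle_in_r : forall a c c' : arrow Q, src c = tgt a -> src c' = tgt a ->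
    varr c * varr a \in I -> varr c' * varr a \in I -> c = c' }.

End PathAlgebra.

(** * Strings *)

Section Words.
Variable Q : quiver.

(* [(a, true)] is the direct letter a, [(a, false)] its formal inverse. *)
Definition letter : Type := (arrow Q * bool)%type.
HB.instance Definition _ := Choice.on letter.

Definition direct (c : letter) : bool := c.2.
Definition lsrc (c : letter) : vertex Q := if c.2 then src c.1 else tgt c.1.
Definition ltgt (c : letter) : vertex Q := if c.2 then tgt c.1 else src c.1.
Definition linv (c : letter) : letter := (c.1, ~~ c.2).

(* As for paths, g_n ... g_1 is stored as its starting vertex and
   [:: g_1; ...; g_n]. *)
Definition word : Type := (vertex Q * seq letter)%type.

Definition wsrc (w : word) : vertex Q := w.1.
Definition wlet (w : word) : seq letter := w.2.
Definition wtgt (w : word) : vertex Q := walk_end ltgt (wsrc w) (wlet w).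
Definition winv (w : word) : word := (wtgt w, rev (map linv (wlet w))).

(* The vertices at positions 0, ..., n of g_n ... g_1. *)
Definition wvert (w : word) (i : nat) : vertex Q :=
  walk_end ltgt (wsrc w) (take i (wlet w)).

(* No letter is followed by its inverse. *)
Definition reduced (w : word) : bool :=
  sorted (fun c d => d != linv c) (wlet w).

Definition subpath (p : qpath Q) (w : word) : bool :=
  (parrows p != [::]) && infix [seq (a, true) | a <- parrows p] (wlet w).

Lemma walk_onth x (l : seq letter) i c : walk lsrc ltgt x l ->
  onth l i = Some c ->
  walk_end ltgt x (take i l) = lsrc c /\ walk_end ltgt x (take i.+1 l) = ltgt c.
Proof.
elim: l x i => [|d l IH] x [|i] //= /andP[/eqP sd W].
  by case=> <-; rewrite take0.
by move=> /(IH _ _ W).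
Qed.

End Words.

Section Strings.
Variables (k : fieldType) (Q : quiver) (I : ideal (pathalg k Q)).

Definition avoids (w : word Q) : Prop :=
  forall p : qpath Q, subpath p w -> pelt k p \notin I.

Record string := String {
  sword :> word Q;
  string_walk : walk (@lsrc Q) (@ltgt Q) (wsrc sword) (wlet sword);
  string_reduced : reduced sword;
  string_avoids : avoids sword;
  string_avoids_inv : avoids (winv sword) }.

Definition slen (C : string) : nat := size (wlet C).

(* Strings C and C^-1 are identified. *)
Definition same_string (C D : string) : Prop :=
  sword C = sword D \/ sword C = winv (sword D).

(* C = FED *)
Record factorization (C : string) := Factorization {
  fac_F : string;
  fac_E : string;
  fac_D : string;
  fac_srcD : wsrc fac_D = wsrc C;
  fac_srcE : wsrc fac_E = wtgt fac_D;
  fac_srcF : wsrc fac_F = wtgt fac_E;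
  fac_cat : wlet C = wlet fac_D ++ wlet fac_E ++ wlet fac_F }.

(* Conditions on the first (rightmost) and the last (leftmost) letter, which
   hold when the string is lazy. *)
Definition first_letter (P : pred (letter Q)) (C : string) : bool :=
  if wlet C is c :: _ then P c else true.
Definition last_letter (P : pred (letter Q)) (C : string) : bool :=
  if wlet C is c :: l then P (last c l) else true.

(* E is the top part of C = FED: the arrows joining E to F and D leave E, and
   M(E) is a quotient of M(C). *)
Definition is_factor (C : string) (f : factorization C) : bool :=
  last_letter (fun c => ~~ direct c) (fac_D f)
  && first_letter (@direct Q) (fac_F f).

(* Dually, the arrows joining E to F and D enter E, and M(E) is a submodule of
   M(C).  This is how "substring" is read opposite "factor" in the description
   of Fac X: with arbitrary subwords E that description fails.  Over the quiver
   1 -a-> 2 -b-> 3 without relations, M(ba) is covered by the subwords a and b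
   but is not a quotient of copies of M(a) (+) M(b): every morphism from
   M(a) or M(b) to it vanishes at the vertex 1. *)
Definition is_sub (C : string) (f : factorization C) : bool :=
  last_letter (@direct Q) (fac_D f)
  && first_letter (fun c => ~~ direct c) (fac_F f).

Definition factor_of (E C : string) : Prop :=
  exists2 f : factorization C, is_factor f & same_string (fac_E f) E.

(* The t-th letter of C (counted from 0) lies in the middle part of f. *)
Definition covers (C : string) (f : factorization C) (t : nat) : bool :=
  (slen (fac_D f) <= t < slen (fac_D f) + slen (fac_E f))%N.

End Strings.

(** * String modules *)

Section StringModule.
Variables (k : fieldType) (Q : quiver) (I : ideal (pathalg k Q)).
Variable gI : gentle I.
Variable C : string I.

Local Notation n := (slen C).+1.
Local Notation l := (wlet C).

Implicit Types (a b : arrow Q) (x y : vertex Q).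

Definition act_entry a (i j : nat) : bool :=
  (i == j.+1) && (onth l j == Some (a, true))
  || (j == i.+1) && (onth l i == Some (a, false)).

(* Column j of each matrix is the image of the basis vector z_j. *)
Definition act_arrow a : 'M[k]_n := \matrix_(i, j) (act_entry a i j)%:R.
Definition act_lazy x : 'M[k]_n :=
  \matrix_(i, j) ((i == j) && (wvert C j == x))%:R.
Definition act_arrows (s : seq (arrow Q)) : 'M[k]_n :=
  foldr (fun a M => M *m act_arrow a) 1%:M s.
Definition act_path (p : qpath Q) : 'M[k]_n :=
  act_arrows (parrows p) *m act_lazy (psrc p).
Definition act (u : pathalg k Q) : 'M[k]_n := lin_ext act_path u.

Lemma act_entryP a i j : act_entry a i j ->
  wvert C j = src a /\ wvert C i = tgt a.
Proof.
case/orP=> /andP[/eqP-> /eqP E]; have [] := walk_onth (string_walk C) E;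
  by rewrite /wvert => -> ->.
Qed.

Lemma act_lazy_diag x : act_lazy x = diag_mx (\row_j (wvert C j == x)%:R).
Proof.
apply/matrixP=> i j; rewrite !mxE.
by case: eqVneq => [->|] /=; rewrite ?mulr1n ?mulr0n.
Qed.

Lemma act_lazyM x y :
  act_lazy x *m act_lazy y = if x == y then act_lazy x else 0.
Proof.
rewrite {1}act_lazy_diag mul_diag_mx; apply/matrixP=> i j; rewrite !mxE.
rewrite -natrM mulnb; case: (eqVneq x y) => [<-|N]; rewrite !mxE.
  by case: (eqVneq i j) => [->|] /=; rewrite ?andbb ?andbF.
case: (eqVneq i j) => [->|] /=; last by rewrite andbF.
by case: eqP => //= ->; rewrite (negPf N).
Qed.

Lemma act_lazy_sum : \sum_x act_lazy x = 1%:M.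
Proof.
apply/matrixP=> i j; rewrite summxE !mxE.
rewrite (bigD1 (wvert C j)) //= big1 ?addr0 => [|x N]; rewrite !mxE.
  by rewrite eqxx andbT.
by rewrite (eq_sym _ x) (negPf N) andbF.
Qed.

Lemma act_lazy_arrow a : act_lazy (tgt a) *m act_arrow a = act_arrow a.
Proof.
rewrite act_lazy_diag mul_diag_mx; apply/matrixP=> i j; rewrite !mxE.
case E: (act_entry a i j); last by rewrite mulr0.
by case/act_entryP: E => _ ->; rewrite eqxx mulr1.
Qed.

Lemma act_arrow_lazy a : act_arrow a *m act_lazy (src a) = act_arrow a.
Proof.
rewrite act_lazy_diag mul_mx_diag; apply/matrixP=> i j; rewrite !mxE.
case E: (act_entry a i j); last by rewrite mul0r.
by case/act_entryP: E => -> _; rewrite eqxx mulr1.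
Qed.

Lemma act_arrows_cat s1 s2 :
  act_arrows (s1 ++ s2) = act_arrows s2 *m act_arrows s1.
Proof.
elim: s1 => [|a s IH] /=; first by rewrite mulmx1.
by rewrite IH mulmxA.
Qed.

Lemma act_lazy_path p : act_lazy (ptgt p) *m act_path p = act_path p.
Proof.
rewrite /act_path /ptgt.
have := qpath_walk p; rewrite -/(psrc p) -/(parrows p).
elim: (parrows p) (psrc p) => [|a s IH] x /=.
  by rewrite mul1mx act_lazyM eqxx.
move=> /andP[/eqP sa W]; have := IH _ W.
set T := act_lazy _; set M := act_arrows s => E.
by rewrite -act_lazy_arrow !mulmxA -(mulmxA T) E.
Qed.

Lemma act_pathM q p : oapp act_path 0 (pcomp q p) = act_path q *m act_path p.
Proof.
case: (eqVneq (ptgt p) (psrc q)) => [E|N].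
  case: (pcompP E) => r -> [Sr Ar] /=.
  rewrite [in RHS]/act_path -mulmxA -E act_lazy_path /act_path Sr Ar.
  by rewrite act_arrows_cat mulmxA.
rewrite pcomp_none //= -(act_lazy_path p) /act_path -!mulmxA.
by rewrite (mulmxA (act_lazy (psrc q))) act_lazyM eq_sym (negPf N) mul0mx mulmx0.
Qed.

Lemma actP c u v : act (c *: u + v) = c *: act u + act v.
Proof. exact: lin_extP. Qed.

Lemma act_pelt p : act (pelt k p) = act_path p.
Proof. exact: lin_ext_pelt. Qed.

Lemma actM u v : act (u * v) = act u *m act v.
Proof.
move: u; pose f1 u := act (u * v); pose g1 u := act u *m act v.
apply: (@pathalg_ext _ _ _ f1 g1) => [t u u'|t u u'|q]; rewrite /f1 /g1.
- by rewrite -actP; congr act; apply: pathalg_mulPl.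
- by rewrite actP mulmxDl scalemxAl.
move: v {f1 g1}.
pose f2 v := act (pelt k q * v); pose g2 v := act (pelt k q) *m act v.
apply: (@pathalg_ext _ _ _ f2 g2) => [t v v'|t v v'|p]; rewrite /f2 /g2.
- by rewrite -actP; congr act; apply: pathalg_mulPr.
- by rewrite actP mulmxDr scalemxAr.
rewrite !act_pelt -act_pathM.
have -> : pelt k q * pelt k p = pmul k q p by apply: pathalg_mul_pelt.
rewrite /pmul; case: (pcomp q p) => [r|] /=; first exact: act_pelt.
exact: lin_ext0.
Qed.

Lemma act1 : act 1 = 1%:M.
Proof.
rewrite -act_lazy_sum /act [1]/(pathalg_one k Q) /pathalg_one lin_ext_sum.
by apply: eq_bigr => x _; rewrite lin_ext_pelt /act_path /= mul1mx.
Qed.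

Lemma infix_two (T : eqType) (s : seq T) i c d :
  onth s i = Some c -> onth s i.+1 = Some d -> infix [:: c; d] s.
Proof.
elim: s i => [|e s IH] [|i] //=.
  case=> ->; case: s {IH} => [|f s] //= [->].
  by rewrite eqxx /= eqxx /= prefix0s.
by move=> H1 H2; rewrite (IH i) ?orbT.
Qed.

Lemma act_entry_comp a b i j m :
  act_entry b i m -> act_entry a m j ->
  infix [:: (a, true); (b, true)] l \/
  infix [:: (a, true); (b, true)] (wlet (winv C)).
Proof.
move=> /orP[]/andP[/eqP Hi /eqP Eb] /orP[]/andP[/eqP Hm /eqP Ea].
- by left; apply: (infix_two (i := j)); rewrite // -Hm.
- by rewrite Ea in Eb.
- by move: Hm; rewrite Hi => -[Ej]; rewrite -Ej Eb in Ea.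
right; rewrite /winv /wlet /= -[[:: _; _]]revK infix_rev.
have -> : rev [:: (a, true); (b, true)] = map (@linv Q) [:: (b, false); (a, false)].
  by [].
rewrite Hi in Ea; have /infixP[s1 [s2 E]] := infix_two Eb Ea.
by rewrite -/(wlet C) E !map_cat; apply/infixP; do 2!eexists.
Qed.

Lemma act_ideal u : u \in I -> act u = 0.
Proof.
case: (gentle_gen gI) => S S2 genI Iu.
have /(_ (fun v => act v = 0)) := (proj1 (genI u) Iu); apply.
  split=> [|v w Hv Hw|v w Hw|v w Hw].
  - exact: lin_ext0.
  - by rewrite /act lin_extB -!/(act _) Hv Hw subr0.
  - by rewrite actM Hw mulmx0.
  - by rewrite actM Hw mul0mx.
move=> _ [p Sp ->]; rewrite act_pelt.
have Ip : pelt k p \in I by apply/genI => J _; apply; exists p.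
suff: act_arrows (parrows p) = 0 by rewrite /act_path => ->; rewrite mul0mx.
have := S2 p Sp; case Ep: (parrows p) => [|a [|b []]] //= _; rewrite mul1mx.
apply/matrixP=> i j; rewrite !mxE big1 // => m _; rewrite !mxE.
case Eb: (act_entry b i m); last by rewrite mul0r.
case Ea: (act_entry a m j); last by rewrite mulr0.
by have [H|H] := act_entry_comp Eb Ea;
  [have := string_avoids (s := C) (p := p) | have := string_avoids_inv (s := C) (p := p)];
  rewrite /subpath Ep /= H Ip => /(_ isT).
Qed.

(* M(C) has the standard basis z_0, ..., z_n of column vectors. *)
Definition strmod of gentle I : Type := 'cV[k]_n.

HB.instance Definition _ := GRing.Zmodule.on (strmod gI).

Definition strmod_scale (u : quot_ring I) (v : strmod gI) : strmod gI :=
  act (repr u) *m v.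

Lemma act_repr (u : pathalg k Q) : act (repr (\pi_(quot_ring I) u)) = act u.
Proof.
apply/eqP; rewrite -subr_eq0 -[_ - _]lin_extB; apply/eqP/act_ideal.
by apply/quot_ring_eqP; rewrite reprK.
Qed.

Lemma strmod_scaleA u v w :
  strmod_scale u (strmod_scale v w) = strmod_scale (u * v) w.
Proof.
rewrite -[u]reprK -[v]reprK [_ * _](pi_quot_mul I) /strmod_scale !act_repr.
by rewrite actM mulmxA.
Qed.
Lemma strmod_scale1 : left_id 1 strmod_scale.
Proof. by move=> w; rewrite /strmod_scale [1]/(quot_one I) act_repr act1 mul1mx. Qed.
Lemma strmod_scaleDr : right_distributive strmod_scale +%R.
Proof. by move=> u v w; apply: mulmxDr. Qed.
Lemma strmod_scaleDl w : {morph strmod_scale^~ w : u v / u + v}.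
Proof.
move=> u v; rewrite -[u]reprK -[v]reprK -pi_quotD /strmod_scale !act_repr.
by rewrite /act lin_extD mulmxDl.
Qed.

HB.instance Definition _ := GRing.Zmodule_isLmodule.Build (quot_ring I)
  (strmod gI) strmod_scaleA strmod_scale1 strmod_scaleDr strmod_scaleDl.

End StringModule.

(* Main.v *)
Require Import Defs.
From HB Require Import structures.
From mathcomp Require Import all_boot all_order all_algebra.
From mathcomp Require Import generic_quotient.

Set Implicit Arguments.
Unset Strict Implicit.
Unset Printing Implicit Defensive.

Import GRing.Theory.
Local Open Scope ring_scope.
Local Open Scope quotient_scope.

(** Write [z_0, ..., z_n] for the standard basis of a string module.  As the
    string is reduced, every arrow acts on this basis as a partial injection.
    A homomorphism between string modules can therefore be studied through its
    support, a relation between the positions of two strings.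

    Let [G] be the matrix of a homomorphism from [M(X)] to [M(Y)].  Comparing
    entries in [G a = a G] for an arrow [a] shows that if the entry of [G] at
    the positions [(y, x)] is nonzero, then an arrow entering [x] also enters
    [y], an arrow leaving [y] also leaves [x], and in both cases the entry at
    the two other ends is again nonzero ([nonzero_graph_relation]).  Now start
    at a nonzero entry and read the two strings, to the left and to the right,
    as long as their letters agree.  A letter of [X] at which the reading stops
    cannot be an arrow entering the common segment [E], and a letter of [Y] at
    which it stops cannot be an arrow leaving [E] ([common_segment]).  So [E]
    is a factor of [X], and a substring of [Y] spanning a submodule
    ([hom_sub_factor]).  When [M(Y)] is a quotient of copies of the sum of the
    [M(X_i)], for every [t] some homomorphism from some [M(X_i)] has a nonzero
    coordinate at [z_t], and therefore every position of [Y] lies in such an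
    [E].

    Conversely, a common segment of this kind, viewed as a set of pairs of
    positions, satisfies the same two closure conditions
    ([segment_graph_relation]), and the two conditions are what is needed for
    its 0/1 matrix to be a homomorphism ([relation_mx_intertwines]); this
    homomorphism reaches every [z_t] with [t] in [E] ([sub_factor_hom]).

    It remains to pass between positions and letters.  Every position of a
    string that is not lazy is an end of a letter; conversely, a submodule
    containing the basis vector at the tail of an arrow contains the one at
    the head, so a submodule substring that contains the tail of a letter
    contains that letter ([sub_covers_direct], [sub_covers_inverse]). *)

(** * Positions in a word *)

(** A position in a word, given by what is read from it in the two directions:
    the zipper [(u, v)] stands between [u^-1] and [v] in the word [u^-1 v].
    The two sides have the same form, so that the reversal of the word becomes
    the exchange of the components ([flip]), and every argument about the right
    side also serves for the left side and for [C^-1]. *)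
Notation zipper Q := (seq (letter Q) * seq (letter Q))%type.

Section Zippers.
Variable Q : quiver.
Implicit Types (a : arrow Q) (c d : letter Q) (l u v D E F : seq (letter Q)).

Definition invw l : seq (letter Q) := rev (map (@linv Q) l).

Lemma linvK : involutive (@linv Q).
Proof. by case=> a b; rewrite /linv negbK. Qed.

Lemma invwK : involutive invw.
Proof.
by move=> l; rewrite /invw map_rev revK -map_comp (eq_map linvK) map_id.
Qed.

Lemma invw_cat l1 l2 : invw (l1 ++ l2) = invw l2 ++ invw l1.
Proof. by rewrite /invw map_cat rev_cat. Qed.

Lemma invw_cons c l : invw (c :: l) = rcons (invw l) (linv c).
Proof. by rewrite /invw /= rev_cons. Qed.

Lemma size_invw l : size (invw l) = size l.
Proof. by rewrite size_rev size_map. Qed.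

Implicit Types x y z : zipper Q.

Definition zword z := invw z.1 ++ z.2.
Definition flip z : zipper Q := (z.2, z.1).
Definition zip_at l i : zipper Q := (invw (take i l), drop i l).

(** Reading [c] away from [z], in one of the two directions, leads to [z'].
    For the direct letter [(a, true)] this means that the arrow [a] maps the
    basis vector at [z] to the one at [z'], for [(a, false)] the opposite. *)
Definition step c z z' : Prop :=
  (z.2 = c :: z'.2 /\ z'.1 = linv c :: z.1) \/
  (z.1 = c :: z'.1 /\ z'.2 = linv c :: z.2).

Lemma step_flip c z z' : step c z z' -> step c (flip z) (flip z').
Proof. by case=> -[? ?]; [right|left]. Qed.

Lemma step_linv c z z' : step c z z' -> step (linv c) z' z.
Proof.
case: z z' => [u v] [u' v'].
by case=> /= -[-> ->]; [right|left]; rewrite linvK.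
Qed.

Lemma step_zword c z z' : step c z z' -> zword z' = zword z.
Proof.
case: z z' => [u v] [u' v']; rewrite /zword.
by case=> /= -[-> ->]; rewrite invw_cons ?linvK cat_rcons.
Qed.

Lemma zword_flip z : zword (flip z) = invw (zword z).
Proof. by rewrite /zword invw_cat invwK. Qed.

Lemma zword_at l i : zword (zip_at l i) = l.
Proof. by rewrite /zword /= invwK cat_take_drop. Qed.

Lemma size_zip_at l i : (i <= size l)%N -> size (zip_at l i).1 = i.
Proof. by move=> le; rewrite size_invw size_takel. Qed.

Lemma zip_at_zword z : zip_at (zword z) (size z.1) = z.
Proof.
case: z => u v; rewrite /zip_at /zword /= -(size_invw u).
by rewrite take_size_cat // drop_size_cat // invwK.
Qed.

Lemma size_zword z : size (zword z) = (size z.1 + size z.2)%N.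
Proof. by rewrite size_cat size_invw. Qed.

(** At a position [(u, v)] of a reduced word the two sides begin with distinct
    letters; at positions of two different words, a common head on opposite
    sides is what calls for reversing one of them. *)
Definition same_head u v : bool :=
  if (u, v) is (c :: _, d :: _) then c == d else false.

Lemma same_headC u v : same_head u v = same_head v u.
Proof. by case: u v => [|c u] [|d v] //=; rewrite /same_head eq_sym. Qed.

Lemma same_headP u v :
  reflect (exists2 c, ohead u = Some c & ohead v = Some c) (same_head u v).
Proof.
case: u v => [|c u] [|d v]; try by apply: (iffP idP) => // -[].
by apply: (iffP eqP) => [->|[_ [->] [->]] //]; exists d.
Qed.

(** Two positions of reduced words can always be compared without a crossed
    match, after reversing one word if necessary: each letter occurs on at most
    one side of either position, so a crossed match excludes a straight one. *)
Lemma same_head_cross u v u' v' : ~~ same_head u v -> ~~ same_head u' v' ->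
  same_head u v' || same_head v u' -> ~~ same_head v v' && ~~ same_head u u'.
Proof.
have same_head_trans s t w : same_head s t -> same_head t w -> same_head s w.
  move=> /same_headP[c sc tc] /same_headP[d]; rewrite tc => -[<-] wc.
  by apply/same_headP; exists c.
move=> /negP nuv /negP nuv' /orP[uv'|vu']; apply/andP; split; apply/negP => h.
- by apply: nuv; apply: same_head_trans uv' _; rewrite same_headC.
- by apply: nuv'; apply: same_head_trans uv'; rewrite same_headC.
- by apply: nuv'; apply: same_head_trans h; rewrite same_headC.
- by apply: nuv; apply: same_head_trans h _; rewrite same_headC.
Qed.

Lemma reduced_same_head z : sorted (fun c d => d != linv c) (zword z) ->
  ~~ same_head z.1 z.2.
Proof.
case: z => [[|c u] [|d v]] //; rewrite /zword /same_head /=.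
rewrite invw_cons cat_rcons sorted_cat_cons /= linvK => /andP[_ /andP[]].
by rewrite eq_sym.
Qed.

(** Arrows act as partial injections on the basis: with [c] direct this is
    single-valuedness, with [c] inverse it is injectivity. *)
Lemma step_inj c z z1 z2 : ~~ same_head z.1 z.2 ->
  step c z z1 -> step c z z2 -> z1 = z2.
Proof.
case: z z1 z2 => [u v] [u1 v1] [u2 v2]; rewrite /step /same_head /=.
move=> sh [] [E1 ->] [] [E2 ->].
- by move: E2; rewrite E1 => -[->].
- by move: sh; rewrite E1 E2 eqxx.
- by move: sh; rewrite E1 E2 eqxx.
- by move: E2; rewrite E1 => -[->].
Qed.

Definition starts (P : pred (letter Q)) l := if l is c :: _ then P c else true.

(** The two closure conditions shared by the support of a homomorphism from
    [M(X)] to [M(Y)] and by the graph of a common factor and submodule.  If an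
    arrow [a] enters [x], then the image of [z_x] is a multiple of [a], so that
    [a] also enters [y]; if [a] leaves [y], then [a] does not kill the image of
    [z_x], so that it does not kill [z_x] and leaves [x] as well. *)
Definition graph_relation (R : zipper Q -> zipper Q -> bool) : Prop :=
  (forall a y x x', R y x -> step (a, false) x x' ->
     exists2 y', step (a, false) y y' & R y' x') /\
  (forall a y y' x, R y x -> step (a, true) y y' ->
     exists2 x', step (a, true) x x' & R y' x').

Lemma flipK : involutive flip. Proof. by case. Qed.

Lemma graph_relation_flipr R :
  graph_relation R -> graph_relation (fun y x => R y (flip x)).
Proof.
case=> R1 R2; split=> [a y x x' Ryx /step_flip|a y y' x Ryx].
  exact: R1.
move=> /(R2 _ _ _ _ Ryx)[x' /step_flip sx' Ryx'].
by exists (flip x'); rewrite ?flipK // -[x]flipK.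
Qed.

Lemma graph_relation_flipl R :
  graph_relation R -> graph_relation (fun y x => R (flip y) x).
Proof.
case=> R1 R2; split=> [a y x x' Ryx|a y y' x Ryx /step_flip]; last exact: R2.
move=> /(R1 _ _ _ _ Ryx)[y' /step_flip sy' Ryx'].
by exists (flip y'); rewrite ?flipK // -[y]flipK.
Qed.

Definition reduced_relation R := forall y x, R y x ->
  ~~ same_head y.1 y.2 && ~~ same_head x.1 x.2.

(** Each letter common to [vX] and [vY] is transported by one of the two closure
    conditions, according to its direction; at the first disagreement the same
    conditions force the direction of the next letter of either word.  The
    hypotheses on [same_head] exclude the only other possibility, that a letter
    on the right of one word is matched with a letter on the left of the
    other. *)
Lemma common_prefix R : graph_relation R -> reduced_relation R ->
  forall vX uX uY vY, R (uY, vY) (uX, vX) ->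
  ~~ same_head uX vY -> ~~ same_head vX uY ->
  exists E FX FY, [/\ vX = E ++ FX, vY = E ++ FY,
    starts (@direct Q) FX, starts (fun c => ~~ direct c) FY &
    R (invw E ++ uY, FY) (invw E ++ uX, FX)].
Proof.
case=> R1 R2 redR.
have out uX vX uY vY a : R (uY, (a, true) :: vY) (uX, vX) ->
    ~~ same_head uX ((a, true) :: vY) -> exists2 vX', vX = (a, true) :: vX' &
    R (linv (a, true) :: uY, vY) (linv (a, true) :: uX, vX').
  move=> Ryx sh.
  case: (R2 a _ (linv (a, true) :: uY, vY) _ Ryx); first by left.
  case=> u' v' []/= [E1 E2] R'; first by exists v'; rewrite -?E2.
  by move: sh; rewrite E1 /same_head eqxx.
have inn uX vX uY vY a : R (uY, vY) (uX, (a, false) :: vX) ->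
    ~~ same_head ((a, false) :: vX) uY -> exists2 vY', vY = (a, false) :: vY' &
    R (linv (a, false) :: uY, vY') (linv (a, false) :: uX, vX).
  move=> Ryx sh.
  case: (R1 a _ _ (linv (a, false) :: uX, vX) Ryx); first by left.
  case=> u' v' []/= [E1 E2] R'; first by exists v'; rewrite -?E2.
  by move: sh; rewrite E1 /same_head eqxx.
elim=> [|c vX IH] uX uY vY Ryx sh1 sh2.
  exists [::], [::], vY; split=> //.
  case: vY Ryx sh1 sh2 => [|[a []] vY] // Ryx sh1 _.
  by case: (out _ _ _ _ _ Ryx sh1).
have [/eqP same|diff] := boolP (take 1 vY == [:: c]).
  case: vY Ryx sh1 sh2 same => [|d vY] //= Ryx sh1 sh2 [dc _]; subst d.
  have R' : R (linv c :: uY, vY) (linv c :: uX, vX).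
    case: c Ryx sh1 sh2 => a [] Ryx sh1 sh2.
      by case: (out _ _ _ _ _ Ryx sh1) => _ [<-].
    by case: (inn _ _ _ _ _ Ryx sh2) => _ [<-].
  have /andP[/= shY shX] := redR _ _ R'.
  case: (IH _ _ _ R'); [exact: shY | by rewrite same_headC; exact: shX|].
  move=> E [FX [FY [-> -> dX iY RE]]]; exists (c :: E), FX, FY; split=> //.
  by rewrite invw_cons !cat_rcons.
exists [::], (c :: vX), vY; split=> //.
  case: c {IH} Ryx sh1 sh2 diff => a [] //= Ryx sh1 sh2.
  by case: (inn _ _ _ _ _ Ryx sh2) => v' ->; rewrite /= take0 eqxx.
case: vY Ryx sh1 sh2 diff => [|[a []] vY] //= Ryx sh1 sh2.
by case: (out _ _ _ _ _ Ryx sh1) => v' [-> _]; rewrite take0 eqxx.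
Qed.

(** The segment is obtained by reading to the right, and then by reading to the
    right in the two reversed words. *)
Lemma common_segment R y x : graph_relation R -> reduced_relation R -> R y x ->
  ~~ same_head x.1 y.2 -> ~~ same_head x.2 y.1 ->
  exists E DX FX DY FY, [/\ zword x = DX ++ E ++ FX /\ zword y = DY ++ E ++ FY,
    starts (@direct Q) FX && starts (@direct Q) (invw DX),
    starts (fun c => ~~ direct c) FY && starts (fun c => ~~ direct c) (invw DY),
    (size DY <= size y.1 <= size DY + size E)%N &
    R (invw DY, E ++ FY) (invw DX, E ++ FX)].
Proof.
case: x y => uX vX [uY vY] grR redR Ryx /= sh1 sh2.
have [ER [FX [FY [EvX EvY dFX iFY _]]]] := common_prefix grR redR Ryx sh1 sh2.
have grR' := graph_relation_flipr (graph_relation_flipl grR).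
have redR' : reduced_relation (fun y x => R (flip y) (flip x)).
  by move=> y x /redR; rewrite /= ![same_head _.2 _]same_headC.
have [EL [DX [DY [EuX EuY dDX iDY RD]]]] :=
  common_prefix grR' redR' (Ryx : R (flip (vY, uY)) (flip (vX, uX))) sh2 sh1.
exists (invw EL ++ ER), (invw DX), FX, (invw DY), FY.
rewrite /zword EuX EvX EuY EvY /= !invw_cat !invwK -!catA dFX dDX iFY iDY.
split=> //; last by rewrite -EvX -EvY.
by rewrite !size_cat !size_invw addnC leq_addr /= addnA leq_addr.
Qed.

(** The position [z] of a word [E], seen in [D E F]. *)
Definition extend D F z : zipper Q := (z.1 ++ invw D, z.2 ++ F).
Definition zippers E := [seq zip_at E i | i <- iota 0 (size E).+1].

Lemma mem_zippers E z : (z \in zippers E) = (zword z == E).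
Proof.
apply/mapP/eqP=> [[i _ ->]|<-]; first exact: zword_at.
exists (size z.1); last by rewrite zip_at_zword.
by rewrite mem_iota ltnS size_zword leq_addr.
Qed.

Lemma zword_extend D F z : zword (extend D F z) = D ++ zword z ++ F.
Proof. by rewrite /zword /= invw_cat invwK !catA. Qed.

Lemma step_extend D F c z z' :
  step c z z' -> step c (extend D F z) (extend D F z').
Proof.
case: z z' => [u v] [u' v']; rewrite /step /=.
by case=> -[-> ->]; [left|right].
Qed.

(** A step that starts inside [E] and leaves it has to read the first letter of
    [F] or the inverse of the last letter of [D]. *)
Lemma step_extend_inv D F c z x : starts (predC1 c) F ->
  starts (predC1 c) (invw D) -> step c (extend D F z) x ->
  exists2 z', step c z z' & x = extend D F z'.
Proof.
case: z x => [u v] [u' v'] nF nD []/= [E1 E2].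
  case: v E1 => [|d v] /= E1; first by move: nF; rewrite E1 /= eqxx.
  case: E1 => -> <-; exists (linv c :: u, v); first by left.
  by rewrite /extend E2.
case: u E1 E2 => [|d u] /= E1 E2; first by move: nD; rewrite E1 /= eqxx.
case: E1 => -> <-; exists (u, linv c :: v); first by right.
by rewrite /extend E2.
Qed.

(** The graph of the map that identifies the occurrences of [E] in the words
    [DX E FX] and [DY E FY]; it is a boolean because it gives matrix entries. *)
Definition segment_relation E DX FX DY FY (y x : zipper Q) : bool :=
  has (fun z => (y == extend DY FY z) && (x == extend DX FX z)) (zippers E).

Lemma starts_predC1 (P : pred (letter Q)) c l :
  ~~ P c -> starts P l -> starts (predC1 c) l.
Proof. by case: l => //= d l nPc Pd; apply: contraNneq nPc => <-. Qed.

Lemma segment_relationP E DX FX DY FY y x :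
  reflect (exists z, [/\ zword z = E, y = extend DY FY z & x = extend DX FX z])
          (segment_relation E DX FX DY FY y x).
Proof.
apply: (iffP hasP) => [[z]|[z [Ez -> ->]]].
  by rewrite mem_zippers => /eqP Ez /andP[/eqP-> /eqP->]; exists z.
by exists z; rewrite ?mem_zippers ?Ez ?eqxx.
Qed.

(** An arrow entering a position of [E] in [DX E FX] cannot come from [FX] or
    [DX], whose arrows next to [E] leave [E]; it is therefore a letter of [E],
    and as such it is also found in [DY E FY].  The argument for arrows leaving
    a position of [E] in [DY E FY] is the same. *)
Lemma segment_graph_relation E DX FX DY FY :
  starts (@direct Q) FX -> starts (@direct Q) (invw DX) ->
  starts (fun c => ~~ direct c) FY -> starts (fun c => ~~ direct c) (invw DY) ->
  graph_relation (segment_relation E DX FX DY FY).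
Proof.
move=> dFX dDX iFY iDY; split=> [a y x x'|a y y' x].
  move=> /segment_relationP[z [Ez -> ->]] /step_extend_inv[||z' sz' ->].
  - exact: starts_predC1 dFX.
  - exact: starts_predC1 dDX.
  exists (extend DY FY z'); first exact: step_extend.
  by apply/segment_relationP; exists z'; rewrite (step_zword sz').
move=> /segment_relationP[z [Ez -> ->]] /step_extend_inv[||z' sz' ->].
- by apply: starts_predC1 iFY.
- by apply: starts_predC1 iDY.
exists (extend DX FX z'); first exact: step_extend.
by apply/segment_relationP; exists z'; rewrite (step_zword sz').
Qed.

Lemma segment_relation_functional E DX FX DY FY y y' x :
  segment_relation E DX FX DY FY y x -> segment_relation E DX FX DY FY y' x ->
  y = y'.
Proof.
move=> /segment_relationP[z [Ez -> Ex]] /segment_relationP[z' [Ez' -> Ex']].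
suff -> : z = z' by [].
have : size (extend DX FX z).1 = size (extend DX FX z').1 by rewrite -Ex -Ex'.
rewrite !size_cat => /addIn sz.
by rewrite -(zip_at_zword z) -(zip_at_zword z') Ez Ez' sz.
Qed.

Lemma flip_extend D F z :
  flip (extend D F z) = extend (invw F) (invw D) (flip z).
Proof. by rewrite /flip /extend /= !invwK. Qed.

End Zippers.

(** * Homomorphisms between string modules *)

Section Matrices.
Variables (k : fieldType) (Q : quiver) (I : ideal (pathalg k Q)).
Implicit Types (X Y C : string I) (a : arrow Q) (z : zipper Q).

Definition pos C (i : 'I_(slen C).+1) : zipper Q := zip_at (wlet C) i.

Lemma pos_inj C : injective (@pos C).
Proof.
move=> i j /(congr1 (fun z => size z.1)).
by rewrite !size_zip_at -1?ltnS // => /val_inj.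
Qed.

Lemma zword_pos C i : zword (@pos C i) = wlet C.
Proof. exact: zword_at. Qed.

Lemma posP C z : zword z = wlet C -> exists i, z = @pos C i.
Proof.
move=> zC; have lt : (size z.1 < (slen C).+1)%N.
  by rewrite ltnS /slen -zC size_zword leq_addr.
by exists (Ordinal lt); rewrite /pos -zC zip_at_zword.
Qed.

(** The link between the combinatorics of positions and the matrices by which
    the arrows act. *)
Lemma step_entry C a (i j : 'I_(slen C).+1) :
  step (a, true) (pos j) (pos i) <-> act_entry C a i j.
Proof.
have right (c : letter Q) (p q : 'I_(slen C).+1) :
    (p == q.+1 :> nat) && (onth (wlet C) q == Some c) <->
    (pos q).2 = c :: (pos p).2 /\ (pos p).1 = linv c :: (pos q).1.
  split=> [/andP[/eqP pq /eqP qc]|[E1 E2]].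
    have lt : (q < size (wlet C))%N by rewrite -ltnS -pq.
    have qc' := onth_nth c _ _ _ qc.
    rewrite /pos /zip_at /= pq (drop_nth c) // (take_nth c) // qc'.
    by rewrite /invw map_rcons rev_rcons.
  have := congr1 size E2; rewrite /= !size_zip_at -1?ltnS // => ->.
  rewrite eqxx /= -[in wlet C](zword_pos q) /zword E1.
  by rewrite onth_cat size_invw size_zip_at -1?ltnS // ltnn subnn.
rewrite /act_entry; split.
  case=> [/right->//|[E1 E2]]; apply/orP; right.
  by apply/right; rewrite E1 E2.
by case/orP=> /right[]; [left|right].
Qed.

Lemma reduced_pos C (i : 'I_(slen C).+1) : ~~ same_head (pos i).1 (pos i).2.
Proof.
by apply: reduced_same_head; rewrite zword_pos; exact: string_reduced.
Qed.

Lemma act_varr C a : act C (varr k a) = act_arrow C a.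
Proof. by rewrite /varr act_pelt /act_path /= mul1mx act_arrow_lazy. Qed.

Lemma act_pelt_lazy C (v : vertex Q) :
  act C (pelt k (lazy_path v)) = act_lazy C v.
Proof. by rewrite act_pelt /act_path /= mul1mx. Qed.

Definition intertwines X Y (G : 'M[k]_((slen Y).+1, (slen X).+1)) : Prop :=
  forall u, G *m act X u = act Y u *m G.

(** The path algebra is spanned by products of arrows and lazy paths. *)
Lemma intertwines_gen X Y (G : 'M[k]_((slen Y).+1, (slen X).+1)) :
  (forall a, G *m act_arrow X a = act_arrow Y a *m G) ->
  (forall v, G *m act_lazy X v = act_lazy Y v *m G) -> intertwines G.
Proof.
move=> Ga Gv.
apply: (@pathalg_ext _ _ _ (fun u => G *m act X u) (fun u => act Y u *m G)).
- by move=> c u v; rewrite actP mulmxDr scalemxAr.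
- by move=> c u v; rewrite actP mulmxDl scalemxAl.
move=> p; rewrite !act_pelt /act_path mulmxA -[RHS]mulmxA -Gv mulmxA.
congr (_ *m _); elim: (parrows p) => [|a s IH] /=.
  by rewrite mulmx1 mul1mx.
by rewrite mulmxA IH -mulmxA Ga mulmxA.
Qed.

Definition zvert C z : vertex Q := walk_end (@ltgt Q) (wsrc C) (invw z.1).

Lemma zvert_pos C (i : 'I_(slen C).+1) : zvert C (pos i) = wvert C i.
Proof. by rewrite /zvert /= invwK. Qed.

Lemma act_entry_inj_l C a (i j j' : 'I_(slen C).+1) :
  act_entry C a i j -> act_entry C a i j' -> j = j'.
Proof.
move=> /step_entry/step_linv s1 /step_entry/step_linv s2; apply: pos_inj.
exact: (step_inj (reduced_pos i) s1 s2).
Qed.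

Lemma act_entry_inj_r C a (i i' j : 'I_(slen C).+1) :
  act_entry C a i j -> act_entry C a i' j -> i = i'.
Proof.
move=> /step_entry s1 /step_entry s2; apply: pos_inj.
exact: (step_inj (reduced_pos j) s1 s2).
Qed.

Lemma sum_unique_bool (n : nat) (P : pred 'I_n) :
  (forall i j, P i -> P j -> i = j) ->
  \sum_i (P i)%:R = [exists i, P i]%:R :> k.
Proof.
move=> uP; have [/existsP[i Pi]|nP] := boolP [exists i, P i].
  rewrite (bigD1 i) //= Pi big1 ?addr0 // => j nji.
  by have [/uP/(_ Pi)/eqP|//] := boolP (P j); rewrite (negPf nji).
by rewrite big1 // => i _; move/existsPn/(_ i)/negPf: nP => ->.
Qed.

Definition relation_mx X Y (R : zipper Q -> zipper Q -> bool) :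
    'M[k]_((slen Y).+1, (slen X).+1) :=
  \matrix_(i, j) (R (pos i) (pos j))%:R.

Lemma step_pos C c (i : 'I_(slen C).+1) z : step c (pos i) z ->
  exists j, z = @pos C j.
Proof. by move/step_zword => E; apply: posP; rewrite E zword_pos. Qed.

(** The entries of [G a] and of [a G] count the ways to complete a pair of
    positions by an arrow.  There is at most one way on either side, because
    arrows act as partial injections, and the closure conditions turn a way on
    one side into a way on the other.  As the counts are 0 or 1, this holds over
    any field. *)
Lemma relation_mx_intertwines X Y R : graph_relation R ->
  (forall (i : 'I_(slen Y).+1) (j : 'I_(slen X).+1), R (pos i) (pos j) ->
     zvert Y (pos i) = zvert X (pos j)) ->
  intertwines (relation_mx X Y R).
Proof.
case=> R1 R2 Rv; apply: intertwines_gen => [a|v]; apply/matrixP=> i j.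
  rewrite !mxE.
  under eq_bigr => p _ do rewrite !mxE -natrM mulnb.
  under [RHS]eq_bigr => p _ do rewrite !mxE -natrM mulnb.
  rewrite !sum_unique_bool; last 2 first.
  - by move=> p q /andP[+ _] /andP[+ _]; apply: act_entry_inj_l.
  - by move=> p q /andP[_ +] /andP[_ +]; apply: act_entry_inj_r.
  congr (_%:R); congr nat_of_bool; apply/existsP/existsP=> -[p /andP[]].
    move=> Rip /step_entry/step_linv sp.
    have [y' sy Ry] := R1 _ _ _ _ Rip sp.
    have [q Eq] := step_pos sy; subst y'; exists q; rewrite Ry andbT.
    by apply/step_entry; apply: (step_linv sy).
  move=> /step_entry sp Rpj.
  have [x' sx Rx] := R2 _ _ _ _ Rpj sp.
  have [q Eq] := step_pos sx; subst x'; exists q; rewrite Rx /=.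
  by apply/step_entry.
rewrite !act_lazy_diag mul_mx_diag mul_diag_mx !mxE mulrC.
have [/Rv|] := boolP (R (pos i) (pos j)); last by rewrite !mulr0.
by rewrite !zvert_pos => ->.
Qed.

Definition nonzero_relation X Y (G : 'M[k]_((slen Y).+1, (slen X).+1)) y x :=
  [exists i, [exists j, [&& y == pos i, x == pos j & G i j != 0]]].

Lemma nonzero_relationP X Y (G : 'M[k]_((slen Y).+1, (slen X).+1)) y x :
  reflect (exists i j, [/\ y = pos i, x = pos j & G i j != 0])
          (nonzero_relation G y x).
Proof.
apply: (iffP existsP) => [[i /existsP[j /and3P[/eqP yi /eqP xj Gij]]]|].
  by exists i, j.
by case=> i [j [-> -> Gij]]; exists i; apply/existsP; exists j; rewrite !eqxx.
Qed.

Lemma sum_neq0 (n : nat) (F : 'I_n -> k) :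
  \sum_i F i != 0 -> exists i, F i != 0.
Proof.
move=> sF; apply/existsP; apply: contraNT sF => /existsPn F0.
by rewrite big1 // => i _; apply/eqP; move: (F0 i); rewrite negbK.
Qed.

(** Under either condition one side of [G a = a G] reduces to the given nonzero
    entry of [G], since [a] acts as a partial injection; the sum on the other
    side is then nonzero, and any nonzero term of it gives the new pair. *)
Lemma nonzero_graph_relation X Y (G : 'M[k]_((slen Y).+1, (slen X).+1)) :
  intertwines G -> graph_relation (nonzero_relation G).
Proof.
move=> tG; have Ga a (i : 'I_(slen Y).+1) (j : 'I_(slen X).+1) :
    \sum_p G i p * (act_entry X a p j)%:R =
    \sum_(p < _) (act_entry Y a i p)%:R * G p j.
  have /matrixP/(_ i j) := tG (varr k a); rewrite !act_varr !mxE.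
  by under eq_bigr do rewrite mxE; under [RHS]eq_bigr do rewrite mxE.
split=> [a y x x'|a y y' x] /nonzero_relationP[i [j [-> -> Gij]]] s.
  have [j' Ej] := step_pos s; subst x'.
  have ej : act_entry X a j j' by apply/step_entry; apply: (step_linv s).
  have : \sum_p G i p * (act_entry X a p j')%:R != 0.
    rewrite (bigD1 j) //= ej mulr1 big1 ?addr0 // => p.
    case E: (act_entry X a p j'); last by rewrite mulr0.
    by rewrite (act_entry_inj_r E ej) eqxx.
  rewrite Ga => /sum_neq0[p].
  case E: (act_entry Y a i p); last by rewrite mul0r eqxx.
  rewrite mul1r => Gp; exists (pos p).
    by apply: (@step_linv _ (a, true)); apply/step_entry.
  by apply/nonzero_relationP; exists p, j'.
have [i' Ei] := step_pos s; subst y'.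
have ei : act_entry Y a i' i by apply/step_entry.
have : \sum_(p < _) (act_entry Y a i' p)%:R * G p j != 0.
  rewrite (bigD1 i) //= ei mul1r big1 ?addr0 // => p.
  case E: (act_entry Y a i' p); last by rewrite mul0r.
  by rewrite (act_entry_inj_l E ei) eqxx.
rewrite -Ga => /sum_neq0[p].
case E: (act_entry X a p j); last by rewrite mulr0 eqxx.
rewrite mulr1 => Gp; exists (pos p); first by apply/step_entry.
by apply/nonzero_relationP; exists i', p.
Qed.

(** The lazy paths separate the basis vectors at different vertices. *)
Lemma nonzero_vertex X Y (G : 'M[k]_((slen Y).+1, (slen X).+1)) y x :
  intertwines G -> nonzero_relation G y x -> zvert Y y = zvert X x.
Proof.
move=> tG /nonzero_relationP[i [j [-> -> Gij]]]; rewrite !zvert_pos.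
have /matrixP/(_ i j) := tG (pelt k (lazy_path (wvert Y i))).
rewrite !act_pelt_lazy !act_lazy_diag mul_mx_diag mul_diag_mx !mxE eqxx mul1r.
by case: eqVneq => [//|_ /eqP]; rewrite mulr0 eq_sym (negPf Gij).
Qed.

Lemma nonzero_reduced X Y (G : 'M[k]_((slen Y).+1, (slen X).+1)) :
  reduced_relation (nonzero_relation G).
Proof.
by move=> _ _ /nonzero_relationP[i [j [-> -> _]]]; rewrite !reduced_pos.
Qed.

Variable gI : gentle I.

(** The scalars of [k] act through the multiples of [1] in the path algebra, so
    that a homomorphism is [k]-linear and has a matrix. *)
Lemma strmod_linearE X Y (g : {linear strmod X gI -> strmod Y gI}) :
  exists2 G : 'M[k]_((slen Y).+1, (slen X).+1), intertwines G &
  forall v, g v = G *m v.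
Proof.
pose b j : strmod X gI := delta_mx j 0 : 'cV[k]__.
have gact u (v : strmod X gI) : g (act X u *m v : 'cV[k]__) = act Y u *m g v.
  have := linearZZ g (\pi_(quot_ring I) u) v.
  by rewrite /GRing.scale /= /strmod_scale !act_repr.
have gZ (c : k) (v : 'cV[k]_(slen X).+1) : g (c *: v) = c *: (g v : 'cV[k]__).
  have := gact (c *: (1 : pathalg k Q)) v.
  rewrite /act !lin_extZ -!/(act _ _) !act1 -!scalemxAl.
  by rewrite !mul1mx.
pose G := \matrix_(i, j) (g (b j) : 'cV[k]__) i 0.
have gG v : g v = G *m v.
  have -> : v = \sum_j (v : 'cV[k]__) j 0 *: (delta_mx j 0 : 'cV[k]__).
    by rewrite [LHS]matrix_sum_delta; apply: eq_bigr => j _; rewrite big_ord1.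
  rewrite mulmx_sumr [LHS]raddf_sum; apply: eq_bigr => j _ /=.
  rewrite gZ -scalemxAr; apply: (congr1 (GRing.scale _ : 'cV[k]__ -> 'cV[k]__)).
  apply/colP=> i.
  by rewrite -colE !mxE.
exists G => // u; apply/matrixP=> i j.
by have /colP/(_ i) := gact u (b j); rewrite !gG !mulmxA -!colE !mxE.
Qed.

End Matrices.

(** * Substrings and factors *)

Section Substrings.
Variables (k : fieldType) (Q : quiver) (I : ideal (pathalg k Q)).
Implicit Types (X Y C S : string I) (D E F l : seq (letter Q)) (v : vertex Q).

Local Notation walks := (walk (@lsrc Q) (@ltgt Q)).
Local Notation ends := (walk_end (@ltgt Q)).

Lemma lsrc_linv (c : letter Q) : lsrc (linv c) = ltgt c.
Proof. by case: c => a []. Qed.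
Lemma ltgt_linv (c : letter Q) : ltgt (linv c) = lsrc c.
Proof. by case: c => a []. Qed.

Lemma walk_end_invw v l : walks v l -> ends (ends v l) (invw l) = v.
Proof.
elim: l v => //= c l IH v /andP[/eqP sc W].
by rewrite invw_cons -cats1 walk_end_cat IH //= ltgt_linv.
Qed.

Lemma walk_invw v l : walks v l -> walks (ends v l) (invw l).
Proof.
elim: l v => //= c l IH v /andP[/eqP sc W].
by rewrite invw_cons -cats1 walk_cat IH //= walk_end_invw // lsrc_linv eqxx.
Qed.

Lemma winvK C : winv (winv C) = C :> word Q.
Proof.
case: C => -[v l] /= W _ _ _; rewrite /winv /wtgt /wsrc /wlet /= in W *.
by rewrite -/(invw l) -/(invw (invw l)) walk_end_invw // invwK.
Qed.

(** Strings are closed under inversion, because [avoids] is imposed on a word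
    together with its inverse and [reduced] is symmetric. *)
Lemma string_inv C : {S : string I | sword S = winv C}.
Proof.
have W : walks (wsrc (winv C)) (wlet (winv C)).
  exact: walk_invw (string_walk C).
have R : reduced (winv C).
  have := string_reduced C; rewrite /reduced /winv /= rev_sorted sorted_map.
  apply: sub_sorted => c d /=; apply: contra => /eqP.
  by rewrite linvK => <-.
have A : avoids I (winv (winv C)) by rewrite winvK; apply: string_avoids.
by exists (String W R (@string_avoids_inv _ _ _ C) A).
Qed.

Lemma string_infix C D E F : wlet C = D ++ E ++ F ->
  {S : string I | sword S = (ends (wsrc C) D, E)}.
Proof.
move=> eC; pose w : word Q := (ends (wsrc C) D, E).
have W : walks (wsrc w) (wlet w).
  by have := string_walk C; rewrite eC !walk_cat => /and3P[].
have R : reduced w.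
  have := string_reduced C; rewrite /reduced eC /=.
  by case/cat_sorted2 => _ /cat_sorted2[].
have A : avoids I w.
  move=> p /andP[p0 /infixP[s1 [s2 Es]]]; apply: (string_avoids (s := C)).
  rewrite /subpath p0 eC -[E]/(wlet w) Es; apply/infixP.
  by exists (D ++ s1), (s2 ++ F); rewrite !catA.
have A' : avoids I (winv w).
  move=> p /andP[p0 /infixP[s1 [s2 Es]]]; apply: (string_avoids_inv (s := C)).
  have eCi : wlet (winv C) = invw F ++ wlet (winv w) ++ invw D.
    by transitivity (invw (wlet C)) => //; rewrite eC !invw_cat -catA.
  rewrite /subpath p0 eCi Es; apply/infixP.
  by exists (invw F ++ s1), (s2 ++ invw D); rewrite !catA.
by exists (String W R A A').
Qed.

Lemma factorization_cat C D E F : wlet C = D ++ E ++ F ->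
  exists f : factorization C, [/\ sword (fac_D f) = (wsrc C, D),
    sword (fac_E f) = (ends (wsrc C) D, E) & wlet (fac_F f) = F].
Proof.
move=> eC; have [SD ED] := string_infix (eC : wlet C = [::] ++ D ++ (E ++ F)).
have [SE EE] := string_infix eC.
have eC' : wlet C = (D ++ E) ++ F ++ [::] by rewrite cats0 -catA.
have [SF EF] := string_infix eC'.
have srcD : wsrc SD = wsrc C by rewrite ED.
have srcE : wsrc SE = wtgt SD by rewrite EE ED.
have srcF : wsrc SF = wtgt SE by rewrite EF EE /wtgt /= walk_end_cat.
have cat : wlet C = wlet SD ++ wlet SE ++ wlet SF by rewrite ED EE EF.
by exists (Factorization srcD srcE srcF cat); rewrite /= ED EE EF.
Qed.

Lemma last_letterE (P : pred (letter Q)) C :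
  last_letter P C = starts (fun c => P (linv c)) (invw (wlet C)).
Proof.
rewrite /last_letter; case/lastP: (wlet C) => [|l c] //.
rewrite /invw map_rcons rev_rcons /= linvK.
by case: l => [|d l] //=; rewrite last_rcons.
Qed.

Lemma eq_starts (P P' : pred (letter Q)) l :
  P =1 P' -> starts P l = starts P' l.
Proof. by move=> eP; case: l => //= c l; rewrite eP. Qed.

Lemma is_factorE C (f : factorization C) : is_factor f =
  starts (@direct Q) (wlet (fac_F f)) &&
  starts (@direct Q) (invw (wlet (fac_D f))).
Proof.
rewrite /is_factor last_letterE andbC; congr (_ && _).
by apply: eq_starts => -[a []].
Qed.

Lemma is_subE C (f : factorization C) : is_sub f =
  starts (fun c => ~~ direct c) (wlet (fac_F f)) &&
  starts (fun c => ~~ direct c) (invw (wlet (fac_D f))).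
Proof. by rewrite /is_sub last_letterE andbC. Qed.

Lemma factor_of_inv C S (E : string I) :
  sword S = winv C -> factor_of E S -> factor_of E C.
Proof.
move=> eS [f fac same].
have eC : wlet C = invw (wlet (fac_F f)) ++ invw (wlet (fac_E f)) ++
                   invw (wlet (fac_D f)).
  rewrite -[LHS]invwK -[invw (wlet C)]/(wlet (winv C)) -eS (fac_cat f).
  by rewrite !invw_cat catA.
have [g [gD gE gF]] := factorization_cat eC.
exists g.
  by rewrite is_factorE gF gD /= invwK andbC -is_factorE.
have {gE} gE : sword (fac_E g) = winv (fac_E f).
  rewrite gE /winv; congr (_, _).
  have -> : wsrc C = wtgt (fac_F f).
    have := congr1 (@wsrc Q) (winvK C); rewrite -eS {1}/winv /= => <-.
    rewrite /wtgt (fac_cat f) !walk_end_cat.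
    by rewrite (fac_srcF f) /wtgt (fac_srcE f) /wtgt (fac_srcD f).
  by rewrite /wtgt walk_end_invw ?(string_walk (fac_F f)) // (fac_srcF f).
by case: same => same; [right|left]; rewrite gE same // winvK.
Qed.

Lemma sub_factor_of_segment X Y D E F D' F' :
  wlet Y = D ++ E ++ F -> wlet X = D' ++ E ++ F' ->
  ends (wsrc Y) D = ends (wsrc X) D' ->
  starts (@direct Q) F' && starts (@direct Q) (invw D') ->
  starts (fun c => ~~ direct c) F && starts (fun c => ~~ direct c) (invw D) ->
  exists Z : factorization Y, [/\ is_sub Z, factor_of (fac_E Z) X,
    slen (fac_D Z) = size D & slen (fac_E Z) = size E].
Proof.
move=> eY eX ev dX iY.
have [Z [ZD ZE ZF]] := factorization_cat eY.
have [f [fD fE fF]] := factorization_cat eX.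
exists Z; split; rewrite /slen ?ZD ?ZE //; first by rewrite is_subE ZF ZD.
exists f; first by rewrite is_factorE fF fD.
by left; rewrite ZE fE ev.
Qed.

(** The support of [G] is a graph relation, so its points lie on common
    segments.  If the positions [i] and [j] match crosswise, [X] is replaced by
    [X^-1], which has the same factors up to inversion. *)
Lemma hom_sub_factor X Y (G : 'M[k]_((slen Y).+1, (slen X).+1)) i j :
  intertwines G -> G i j != 0 ->
  exists Z : factorization Y, [/\ is_sub Z, factor_of (fac_E Z) X &
    (slen (fac_D Z) <= i <= slen (fac_D Z) + slen (fac_E Z))%N].
Proof.
move=> tG Gij.
have Rij : nonzero_relation G (pos i) (pos j).
  by apply/nonzero_relationP; exists i, j.
have grR := nonzero_graph_relation tG.
have redR := @nonzero_reduced _ _ _ _ _ G.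
have [/andP[sh1 sh2]|cross] :=
  boolP (~~ same_head (pos j).1 (pos i).2 && ~~ same_head (pos j).2 (pos i).1).
  have [E [DX [FX [DY [FY []]]]]] := common_segment grR redR Rij sh1 sh2.
  rewrite !zword_pos => -[eX eY] dX iY bi /(nonzero_vertex tG).
  rewrite /zvert /= !invwK => ev.
  have [Z [sZ fZ sD sE]] := sub_factor_of_segment eY eX ev dX iY.
  exists Z; split=> //; rewrite sD sE.
  by move: bi; rewrite size_zip_at // -ltnS.
rewrite negb_and !negbK in cross.
have [S eS] := string_inv X.
have grR' := graph_relation_flipr grR.
have redR' : reduced_relation (fun y x => nonzero_relation G y (flip x)).
  by move=> y x /redR; rewrite /= [same_head x.2 _]same_headC.
have /andP[sh1 sh2] := same_head_cross (reduced_pos j) (reduced_pos i) cross.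
rewrite -[pos j]flipK in Rij.
have [E [DX [FX [DY [FY []]]]]] := common_segment grR' redR' Rij sh1 sh2.
rewrite zword_flip !zword_pos => -[eX eY] dX iY bi /(nonzero_vertex tG).
rewrite /zvert /= invwK => ev.
have eSX : wlet S = DX ++ E ++ FX by rewrite eS -eX.
have eX' : wlet X = invw (E ++ FX) ++ invw DX.
  by rewrite -invw_cat -eX invwK.
have WX := string_walk X; rewrite eX' walk_cat in WX.
have ev' : ends (wsrc Y) DY = ends (wsrc S) DX.
  rewrite ev eS /winv /wtgt /= -/(wlet X) eX' walk_end_cat.
  by rewrite -{2}[DX]invwK walk_end_invw //; case/andP: WX.
have [Z [sZ fZ sD sE]] := sub_factor_of_segment eY eSX ev' dX iY.
exists Z; split=> //; first exact: factor_of_inv eS fZ.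
by rewrite sD sE; move: bi; rewrite size_zip_at // -ltnS.
Qed.

Lemma zvert_extend C (f : factorization C) (z : zipper Q) :
  zvert C (extend (wlet (fac_D f)) (wlet (fac_F f)) z) =
  ends (wsrc (fac_E f)) (invw z.1).
Proof.
rewrite /zvert /= invw_cat invwK walk_end_cat.
by rewrite (fac_srcE f) /wtgt (fac_srcD f).
Qed.

Lemma pos_extend C (f : factorization C) (i : 'I_(slen C).+1) :
  (slen (fac_D f) <= i <= slen (fac_D f) + slen (fac_E f))%N ->
  exists2 z, zword z = wlet (fac_E f) &
    pos i = extend (wlet (fac_D f)) (wlet (fac_F f)) z.
Proof.
move=> /andP[le1 le2]; pose z := zip_at (wlet (fac_E f)) (i - slen (fac_D f)).
exists z; first exact: zword_at.
have sz : size (extend (wlet (fac_D f)) (wlet (fac_F f)) z).1 = i.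
  rewrite /= size_cat !size_invw size_takel ?leq_subLR //.
  by rewrite subnK.
rewrite /pos (fac_cat f) -{1}sz.
rewrite -[wlet (fac_E f)](zword_at _ (i - slen (fac_D f))).
by rewrite -zword_extend zip_at_zword.
Qed.

Lemma relation_mx_delta X Y (R : zipper Q -> zipper Q -> bool)
    (i : 'I_(slen Y).+1) (j : 'I_(slen X).+1) :
  (forall y y' x, R y x -> R y' x -> y = y') -> R (pos i) (pos j) ->
  forall i', relation_mx X Y R i' j = (i' == i)%:R :> k.
Proof.
move=> funR Rij i'; rewrite mxE; congr (_%:R); congr nat_of_bool.
by apply/idP/eqP => [/funR/(_ Rij)/pos_inj//|->].
Qed.

(** This is the composite of the surjection from [M(X)] onto [M(E)] with the
    inclusion of [M(E)] in [M(Y)], whose image contains the basis vectors at the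
    positions of [E].  The two cases correspond to the two ways in which [E] can
    be identified with a factor of [X]. *)
Lemma sub_factor_hom X Y (Z : factorization Y) :
  is_sub Z -> factor_of (fac_E Z) X ->
  exists2 G : 'M[k]_((slen Y).+1, (slen X).+1), intertwines G &
  forall i : 'I_(slen Y).+1,
    (slen (fac_D Z) <= i <= slen (fac_D Z) + slen (fac_E Z))%N ->
    exists j, forall i', G i' j = (i' == i)%:R.
Proof.
rewrite is_subE => /andP[iF iD] [f]; rewrite is_factorE => /andP[dF dD] same.
set E := wlet (fac_E Z); set DY := wlet (fac_D Z) in iD *.
set FY := wlet (fac_F Z) in iF *.
suff [R [grR funR vR totR]] : exists R : zipper Q -> zipper Q -> bool,
    [/\ graph_relation R, forall y y' x, R y x -> R y' x -> y = y',
        forall y x, R y x -> zvert Y y = zvert X x &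
        forall z, zword z = E -> exists2 x, zword x = wlet X &
          R (extend DY FY z) x].
  exists (relation_mx X Y R).
    by apply: relation_mx_intertwines => // i j /vR.
  move=> i /pos_extend[z /totR[x /posP[j ->] Rzj] Ei]; exists j.
  by apply: relation_mx_delta => //; rewrite Ei.
have wE z : zword z = E ->
    ends (wsrc (fac_E Z)) (invw z.1) = ends (wtgt (fac_E Z)) (invw z.2).
  have := string_walk (fac_E Z); rewrite /wtgt -/E => W Ez.
  move: W; rewrite -Ez walk_cat walk_end_cat => /andP[_ W].
  by rewrite walk_end_invw.
case: same => eE.
  exists (segment_relation E (wlet (fac_D f)) (wlet (fac_F f)) DY FY); split.
  - exact: segment_graph_relation.
  - exact: segment_relation_functional.
  - move=> y x /segment_relationP[z [Ez -> ->]].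
    by rewrite !zvert_extend eE.
  move=> z Ez; exists (extend (wlet (fac_D f)) (wlet (fac_F f)) z).
    by rewrite zword_extend Ez /E -eE -fac_cat.
  by apply/segment_relationP; exists z.
exists (fun y x => segment_relation E (invw (wlet (fac_F f)))
                     (invw (wlet (fac_D f))) DY FY y (flip x)); split.
- by apply/graph_relation_flipr/segment_graph_relation; rewrite ?invwK.
- by move=> y y' x; apply: segment_relation_functional.
- move=> y x /segment_relationP[z [Ez -> /(congr1 (@flip Q))]].
  rewrite flipK flip_extend !invwK => ->.
  by rewrite !zvert_extend eE wE.
move=> z Ez; exists (extend (wlet (fac_D f)) (wlet (fac_F f)) (flip z)).
  by rewrite zword_extend zword_flip Ez (fac_cat f) eE.
by apply/segment_relationP; exists z; rewrite flip_extend flipK.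
Qed.
End Substrings.

Section Covering.
Variables (k : fieldType) (Q : quiver) (I : ideal (pathalg k Q)).
Variables (Y : string I) (f : factorization Y) (subf : is_sub f).
Implicit Types a : arrow Q.

(** The arrow [a] starts at position [t]; if the segment stopped there, [a]
    would leave it. *)
Lemma sub_covers_direct (t : nat) a : onth (wlet Y) t = Some (a, true) ->
  (slen (fac_D f) <= t <= slen (fac_D f) + slen (fac_E f))%N -> covers f t.
Proof.
move=> Yt /andP[le1 le2]; rewrite /covers le1 ltn_neqAle le2 andbT.
apply/eqP=> E; move: Yt subf; rewrite is_subE (fac_cat f) catA onth_cat.
rewrite size_cat E ltnn subnn; case: (wlet (fac_F f)) => //= c l [->].
by rewrite /direct.
Qed.

(** Here the arrow [a] starts at position [t + 1], so the segment cannot begin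
    there. *)
Lemma sub_covers_inverse (t : nat) a : onth (wlet Y) t = Some (a, false) ->
  (slen (fac_D f) <= t.+1 <= slen (fac_D f) + slen (fac_E f))%N -> covers f t.
Proof.
move=> Yt /andP[le1 le2]; rewrite /covers le2 andbT leqNgt.
apply/negP=> le3; have E : slen (fac_D f) = t.+1.
  by apply/eqP; rewrite eqn_leq le1.
move: Yt subf; rewrite is_subE (fac_cat f) onth_cat -/(slen _) E leqnn.
move: E; rewrite /slen; case/lastP: (wlet (fac_D f)) => // l c.
rewrite size_rcons /invw map_rcons rev_rcons -cats1 onth_cat => -[<-].
by rewrite ltnn subnn /= => -[->]; rewrite andbF.
Qed.
End Covering.

(** * Homomorphisms out of copies of a direct sum *)

Section CopiesOfDirectSum.
Variables (R : pzRingType) (S T : finType) (M : T -> lmodType R).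

Definition dsum_in (s : S) (i : T) (v : M i) : {ffun S -> dsum M} :=
  [ffun s' => [ffun j => if s' == s then dfwith (fun=> 0) v j else 0] : dsum M].

Lemma dsum_in_is_linear s i : linear (@dsum_in s i).
Proof.
move=> a u v; apply/ffunP=> s'; rewrite !ffunE; apply/ffunP=> j; rewrite !ffunE.
case: eqP => _; last by rewrite scaler0 addr0.
have [<-|nij] := eqVneq i j; first by rewrite !dfwith_in.
by rewrite !dfwith_out // scaler0 addr0.
Qed.

HB.instance Definition _ s i :=
  GRing.isLinear.Build R (M i) {ffun S -> dsum M} *:%R (@dsum_in s i)
    (@dsum_in_is_linear s i).

Lemma dsum_sumE (K : finType) (F : K -> dsum M) j :
  (\sum_k F k) j = \sum_k F k j.
Proof. by elim/big_rec2: _ => [|k u v _ <-]; rewrite ffunE. Qed.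

Lemma dsum_in_sum (w : {ffun S -> dsum M}) :
  w = \sum_s \sum_i dsum_in s (w s i).
Proof.
apply/ffunP=> s; rewrite sum_ffunE; apply/ffunP=> i; rewrite dsum_sumE.
under eq_bigr => s' _.
  rewrite sum_ffunE dsum_sumE.
  under eq_bigr => i' _ do rewrite !ffunE.
  over.
rewrite (bigD1 s) //= [X in _ + X]big1 ?addr0 => [|s' ns]; last first.
  by rewrite eq_sym (negPf ns) big1.
rewrite eqxx (bigD1 i) //= dfwith_in big1 ?addr0 // => i' ni.
by rewrite dfwith_out.
Qed.

End CopiesOfDirectSum.

(** * String modules in Fac *)

Theorem theorem7p1 (k : fieldType) (Q : quiver) (I : ideal (pathalg k Q))
    (gI : gentle I) (m : nat) (X : 'I_m -> string I) (Y : string I) :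
  Fac (dsum (fun i : 'I_m => strmod (X i) gI : lmodType (quot_ring I)))
      (strmod Y gI : lmodType (quot_ring I))
  <->
  exists (r : nat) (Z : 'I_r.+1 -> factorization Y),
    [/\ forall j, is_sub (Z j),
        forall j, exists i, factor_of (fac_E (Z j)) (X i)
      & forall t, (t < slen Y)%N -> exists j, covers (Z j) t].
Proof.
set M := fun i : 'I_m => strmod (X i) gI : lmodType (quot_ring I).
split=> [[n [f f_surj]]|[r [Z [subZ facZ covZ]]]].
  (* A preimage of [z_t] is a sum of elements of the summands, so one of them
     has an image with a nonzero coordinate at [t]. *)
  have reach (t : 'I_(slen Y).+1) : exists Z : factorization Y,
      [/\ is_sub Z, exists i, factor_of (fac_E Z) (X i) &
         (slen (fac_D Z) <= t <= slen (fac_D Z) + slen (fac_E Z))%N].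
    have [w fw] := f_surj (delta_mx t 0 : 'cV[k]_(slen Y).+1).
    have : (f w : 'cV[k]_(slen Y).+1) t 0 != 0.
      by rewrite fw mxE !eqxx oner_neq0.
    rewrite [w]dsum_in_sum raddf_sum summxE => /sum_neq0[s].
    rewrite raddf_sum summxE => /sum_neq0[i wsi].
    have [G tG gG] := strmod_linearE
      ([the {linear M i -> strmod Y gI} of f \o @dsum_in _ _ _ M s i]
       : {linear strmod (X i) gI -> strmod Y gI}).
    move: wsi; have /= -> := gG (w s i).
    rewrite mxE => /sum_neq0[j]; rewrite mulf_eq0 negb_or => /andP[Gtj _].
    have [Z [sZ fZ bZ]] := hom_sub_factor tG Gtj.
    by exists Z; split=> //; exists i.
  have [Z HZ] := fin_all_exists reach.
  exists (slen Y), Z; split=> [t|t|t lt]; try by case: (HZ t).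
  (* The letter [t] is covered by the segment through the source of its
     arrow, which is at position [t] or [t + 1]. *)
  case def_c: (onth (wlet Y) t) => [[a d]|]; last first.
    by have := onthTE (wlet Y) t; rewrite def_c -/(slen Y) lt.
  case: d def_c => def_c.
    pose i := Ordinal (ltnW (lt : t.+1 < (slen Y).+1)%N); exists i.
    by have [sZ _ bZ] := HZ i; apply: sub_covers_direct sZ _ _ def_c bZ.
  pose i := Ordinal (lt : t.+1 < (slen Y).+1)%N; exists i.
  by have [sZ _ bZ] := HZ i; apply: sub_covers_inverse sZ _ _ def_c bZ.
(* One copy of the direct sum is used for each position [t] of [Y], and on this
   copy only the summand with index [ix t], mapped to [M(Y)] by [G t]. *)
have reach (t : 'I_(slen Y).+1) :
    exists G : {i & 'M[k]_((slen Y).+1, (slen (X i)).+1)},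
    intertwines (projT2 G) /\ exists j, forall t', projT2 G t' j = (t' == t)%:R.
  have [j bt] : exists j,
      (slen (fac_D (Z j)) <= t <= slen (fac_D (Z j)) + slen (fac_E (Z j)))%N.
    case: (ltnP t (slen Y)) => [/covZ[j /andP[le lt]]|ge].
      by exists j; rewrite le ltnW.
    (* The last position is the end of the last letter, or [Y] is lazy and then
       every segment of it contains its only position. *)
    have Et : t = slen Y :> nat by apply/eqP; rewrite eqn_leq ge -ltnS ltn_ord.
    rewrite Et; case E: (slen Y) => [|n].
      exists ord0; move: E; rewrite /slen (fac_cat (Z ord0)) !size_cat.
      by case: (size _) => //; case: (size _).
    have /covZ[j /andP[le lt]] : (n < slen Y)%N by rewrite E.
    by exists j; rewrite lt ltnW // ltnS.
  have [i facZi] := facZ j.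
  have [G tG HG] := sub_factor_hom (subZ j) facZi.
  by exists (existT _ i G); split; last exact: HG.
have [G HG] := fin_all_exists reach.
have [p Hp] := fin_all_exists (fun t => (HG t).2).
pose ix t := projT1 (G t).
pose f (w : {ffun 'I_(slen Y).+1 -> dsum M}) : strmod Y gI :=
  \sum_t (projT2 (G t) *m (w t (ix t) : 'cV[k]_(slen (X (ix t))).+1)
          : strmod Y gI).
have f_lin : linear f.
  move=> u v w; rewrite /f scaler_sumr -big_split; apply: eq_bigr => t _ /=.
  rewrite !ffunE [LHS]mulmxDr; congr (_ + _).
  by rewrite mulmxA (HG t).1 -mulmxA.
pose F : {linear {ffun 'I_(slen Y).+1 -> dsum M} -> strmod Y gI} :=
  HB.pack f (GRing.isLinear.Build _ _ _ _ f f_lin).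
exists (slen Y).+1, F => y.
(* As [G t] maps the basis vector with index [p t] to [z_t], the coordinate of
   [y] at [t] is put there.  The other summands are mapped to zero, and the same
   formula, by the number [p t], gives them a value of the right type. *)
exists [ffun t => [ffun i =>
  (\col_j ((j == p t :> nat)%:R * (y : 'cV[k]_(slen Y).+1) t 0)
   : 'cV[k]_(slen (X i)).+1) : M i] : dsum M].
rewrite /F /= /f; apply/colP=> t; rewrite summxE.
transitivity (\sum_t' (t == t')%:R * (y : 'cV[k]_(slen Y).+1) t' 0).
  apply: eq_bigr => t' _; rewrite !ffunE mxE (bigD1 (p t')) //= mxE eqxx mul1r.
  rewrite Hp big1 ?addr0 // => j nj.
  rewrite mxE (_ : (j == p t' :> nat) = false) ?mul0r ?mulr0 //.
  exact/negbTE.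
rewrite (bigD1 t) //= eqxx mul1r big1 ?addr0 // => t' nt.
by rewrite eq_sym (negPf nt) mul0r.
Qed.
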